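(* Let $d\ge 2$ and $\alpha\in(0,1/2)$. Let $(\omega_e)_{e\in E_d}$ be i.i.d. random conductances on the nearest-neighbor edges of $\mathbb Z^d$ with $\mathbb P(\omega_e\in[0,1])=1$ and $\mathbb P(\omega_e>0)>p_c(d)$. Suppose that the following limit exists and satisfies $$(4d-2)\,\lim_{u\to 0^+}\frac{\log \mathbb P\big(\omega_e\in[u,2u]\big)}{\log u}<\alpha .$$ Then there exists a constant $c>0$ such that, $\mathbb P_o$-almost surely, for all $n$ large enough (how large may depend on $\omega$), $$\mathsf P^{2n}_\omega(o,o)\ \ge\ c\,\pi(o)\,n^{-(2+\alpha(d-1))}.$$
   Context: $E_d$ is the set of non-oriented nearest-neighbor edges $\{x,y\}$ of $\mathbb Z^d$ ($|x-y|=1$), and $(\omega_e)_{e\in E_d}$ is a family of random conductances on a probability space $(\Omega,\mathbb P)$; write $\omega_{xy}=\omega_{\{x,y\}}$. $p_c(d)$ is the critical probability of Bernoulli bond percolation on $\mathbb Z^d$. $\mathscr C$ is the (a.s. unique) infinite cluster of the percolation configuration in which an edge $e$ is open iff $\omega_e>0$. $o$ is the origin and $\mathbb P_o(\cdot)=\mathbb P(\cdot\mid o\in\mathscr C)$. For given $\omega$, $\pi(x)=\sum_{y:|x-y|=1}\omega_{xy}$ and $\mathsf P_\omega(x,y)=\omega_{xy}/\pi(x)$ for $x,y$ neighbors (used for $x$ with $\pi(x)>0$, in particular for $x\in\mathscr C$). $X=(X_n)_{n\ge0}$ is the discrete-time Markov chain with transition kernel $\mathsf P_\omega$, $P^x_\omega$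 is its (quenched) law started at $x$, and $\mathsf P^n_\omega(x,y)=P^x_\omega(X_n=y)$. *)

(* Defs.v *)
From HB Require Import structures.
From mathcomp Require Import all_boot all_order all_algebra finmap.
From mathcomp Require Import all_classical all_reals all_analysis.

Set Implicit Arguments.
Unset Strict Implicit.
Unset Printing Implicit Defensive.

Import Order.TTheory GRing.Theory Num.Theory.
Import numFieldNormedType.Exports.

Local Open Scope classical_set_scope.
Local Open Scope ring_scope.

Notation lattice d := 'rV[int]_d.

Section Lattice.
Variable d : nat.
Implicit Types (x y : lattice d) (e : {fset lattice d}).

(* On integer vectors the l1 and the Euclidean norm are 1 for the same vectors. *)
Definition neighbor x y : bool := \sum_(i < d) `|x 0 i - y 0 i| == 1.

Lemma neighborC x y : neighbor x y = neighbor y x.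
Proof. by congr (_ == _); apply: eq_bigr => i _; rewrite distrC. Qed.

(* Families indexed by E_d are total functions on {fset lattice d} of which
   only the restriction to [edges] is ever used. *)
Definition edges : set {fset lattice d} :=
  [set e | exists x y, neighbor x y /\ e = [fset x; y]%fset].

Lemma edges_neighbor x y : neighbor x y -> edges [fset x; y]%fset.
Proof. by move=> xy; exists x, y. Qed.

Lemma finite_neighbor x : finite_set [set y | neighbor x y].
Proof.
pose g (f : {ffun 'I_d -> 'I_3}) : lattice d :=
  \row_i (x 0 i + (f i)%:Z - 1).
apply: (@sub_finite_set _ _ (g @` setT)); last exact: finite_image.
move=> y /eqP xy.
have le1 i : `|x 0 i - y 0 i| <= 1.
  by rewrite -xy (bigD1 i)//= lerDl sumr_ge0.
exists [ffun i => inord (absz (y 0 i - x 0 i + 1))] => //.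
apply/rowP => i; rewrite !mxE ffunE.
have := le1 i; rewrite ler_norml => /andP[l1 l2].
have p : 0 <= y 0 i - x 0 i + 1.
  by rewrite -opprB addrC subr_ge0.
rewrite inordK; first by rewrite gez0_abs// addrA addrK addrC subrK.
rewrite -ltz_nat gez0_abs// (@le_lt_trans _ _ (1 + 1))//.
by rewrite lerD2r -opprB lerNl.
Qed.

(* [eta e] is true when the edge [e] is open. *)
Definition open_rel (eta : {fset lattice d} -> bool) : rel (lattice d) :=
  fun x y => neighbor x y && eta [fset x; y]%fset.

Definition cluster (eta : {fset lattice d} -> bool) x : set (lattice d) :=
  [set y | exists s : seq (lattice d), path (open_rel eta) x s /\ last x s = y].

(* The union of all infinite clusters: it is the infinite cluster on the
   event that there is exactly one. *)
Definition infinite_cluster (eta : {fset lattice d} -> bool) :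
  set (lattice d) := [set x | infinite_set (cluster eta x)].

Lemma measurable_infinite_cluster disp (T : measurableType disp)
    (eta : {fset lattice d} -> T -> bool) :
  (forall e, edges e -> measurable [set w | eta e w]) ->
  forall x, measurable [set w | infinite_cluster (eta^~ w) x].
Proof.
move=> meta x.
have mopen y z : measurable [set w | open_rel (eta^~ w) y z].
  rewrite /open_rel; case: (boolP (neighbor y z)) => yz /=.
    exact/meta/edges_neighbor.
  by rewrite (_ : [set _ | _] = set0)//; apply/seteqP; split.
have mpath s : forall y, measurable [set w | path (open_rel (eta^~ w)) y s].
  elim: s => [|z s IH] y /=.
    by rewrite (_ : [set _ | _] = setT)//; apply/seteqP; split.
  rewrite (_ : [set _ | _] = [set w | open_rel (eta^~ w) y z] `&`
      [set w | path (open_rel (eta^~ w)) z s]); first exact: measurableI.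
  by apply/seteqP; split => w /= /andP.
rewrite (_ : [set _ | _] = ~` \bigcup_(F : {fset lattice d}) ~`
  \bigcup_(s : seq (lattice d))
    ([set w | path (open_rel (eta^~ w)) x s] `&`
     [set w : T | last x s \notin F])).
  apply/measurableC/countable_bigcupT_measurable => // F.
  apply/measurableC/countable_bigcupT_measurable => // s.
  apply: measurableI => //; case: (last x s \notin F).
    by rewrite (_ : [set _ | _] = setT)//; apply/seteqP; split.
  by rewrite (_ : [set _ | _] = set0)//; apply/seteqP; split.
apply/seteqP; split => w /=.
  move=> inf [F _]; apply; apply: contrapT => nF; apply: inf.
  apply: (@sub_finite_set _ _ [set` F]); last exact: finite_fset.
  move=> y [s [ps <-]] /=; apply: contrapT => /negP sF.
  by apply: nF; exists s.
move=> H /finite_fsetP[F FE]; apply: H; exists F => // -[s _ [/= ps]].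
move=> /negP; apply.
have : cluster (eta^~ w) x (last x s) by exists s.
by rewrite FE.
Qed.

End Lattice.

Section Probability.
Context {R : realType} {disp disp' : measure_display}.
Context {T : measurableType disp} {T' : measurableType disp'}.
Variable P : probability T R.

Definition mutually_independent (I : choiceType) (E : set I)
    (X : I -> {RV P >-> T'}) : Prop :=
  forall (J : {fset I}) (B : I -> set T'), [set` J] `<=` E ->
    (forall i, measurable (B i)) ->
    P (\bigcap_(i in [set` J]) X i @^-1` B i) =
    (\prod_(i <- J) P (X i @^-1` B i))%E.

Definition identically_distributed (I : choiceType) (E : set I)
    (X : I -> {RV P >-> T'}) : Prop :=
  forall i j, E i -> E j -> forall B, measurable B ->
    distribution P (X i) B = distribution P (X j) B.

Definition iid (I : choiceType) (E : set I) (X : I -> {RV P >-> T'}) : Prop :=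
  mutually_independent E X /\ identically_distributed E X.

(* P(A | D) = P(A `&` D) / P(D); it is P(A) by convention when P(D) = 0. *)
Definition cond_probability (D : set T) (mD : measurable D) :
  probability T R := mnormalize (mrestr P mD) P.

End Probability.

(* p_c(d) = sup {p | theta(p) = 0}, where theta(p) is the probability that the
   origin is in an infinite cluster. As theta(p) depends only on the joint law
   of the edge states, any probability space carrying them may be used. *)
Definition critical_probability (R : realType) (d : nat) : R :=
  sup [set p : R | 0 <= p <= 1 /\
    exists (disp : measure_display) (T : measurableType disp)
           (P : probability T R) (eta : {fset lattice d} -> {RV P >-> bool}),
      [/\ mutually_independent (@edges d) eta,
          forall e, edges e -> P [set w | eta e w] = p%:E &
          P [set w | infinite_cluster (fun e => eta e w) 0] = 0%E]].

Section RandomWalk.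
Variables (R : realType) (d : nat).
Implicit Types (omega : {fset lattice d} -> R) (x y : lattice d).

Definition conductance_sum omega x : R :=
  \sum_(y \in [set y | neighbor x y]) omega [fset x; y]%fset.

Definition transition omega x y : R :=
  if neighbor x y then omega [fset x; y]%fset / conductance_sum omega x else 0.

Fixpoint heat_kernel omega (n : nat) x y : R :=
  if n is m.+1 then
    \sum_(z \in [set z | neighbor y z])
      heat_kernel omega m x z * transition omega z y
  else (x == y)%:R.

End RandomWalk.

Section MarkovChain.
Variables (R : realType) (d : nat) (omega : {fset lattice d} -> R).
Variables (disp : measure_display) (S : measurableType disp).
Variables (Q : probability S R) (x : lattice d) (X : nat -> S -> lattice d).

(* X is, under Q, a Markov chain started at x with kernel [transition omega];
   [markov_chain_heat_kernel] shows that [heat_kernel omega n x y] is Q(X_n = y). *)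
Definition markov_chain : Prop :=
  [/\ forall n y, measurable [set s | X n s = y],
      Q [set s | X 0%N s = x] = 1%E &
      forall n (t : nat -> lattice d),
        Q [set s | forall i, (i <= n.+1)%N -> X i s = t i] =
        (Q [set s | forall i, (i <= n)%N -> X i s = t i]
         * (transition omega (t n) (t n.+1))%:E)%E].

Hypothesis chainX : markov_chain.

Let mX n y : measurable [set s | X n s = y].
Proof. by case: chainX. Qed.

Let mpast n (t : nat -> lattice d) :
  measurable [set s | forall i, (i < n)%N -> X i s = t i].
Proof.
rewrite (_ : [set _ | _] = \bigcap_(i in `I_n) [set s | X i s = t i]).
  by apply: bigcap_measurableType.
by apply/seteqP; split.
Qed.

Let one_step n z y : (Q [set s | X n s = z /\ X n.+1 s = y] =
  Q [set s | X n s = z] * (transition omega z y)%:E)%E.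
Proof.
pose past (h : n.-tuple (lattice d)) :=
  [set s | forall i, (i < n)%N -> X i s = nth 0 h i].
pose F (k : nat) := if (pickle_inv k : option (n.-tuple (lattice d))) is Some h then past h else set0.
have mF k : measurable (F k).
  by rewrite /F; case: pickle_inv => [h|//]; exact: mpast.
have FT : \bigcup_k F k = setT.
  apply/seteqP; split => // s _.
  exists (choice.pickle [tuple X i s | i < n]) => //.
  rewrite /F pickleK_inv => i ni.
  by rewrite -[i]/(nat_of_ord (Ordinal ni)) -tnth_nth tnth_mktuple.
have tF : trivIset setT F.
  apply/trivIsetP => i j _ _ ij; apply/seteqP; split => // s [].
  rewrite /F; have := @pickle_invK (n.-tuple (lattice d)) i.
  have := @pickle_invK (n.-tuple (lattice d)) j.
  case: pickle_inv => [h|]//=; case: pickle_inv => [h'|]//= hj h'i hi hj'.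
  move/eqP: ij; apply; rewrite -hj -h'i; congr choice.pickle.
  apply/val_inj/(@eq_from_nth _ 0); first by rewrite !size_tuple.
  by move=> k; rewrite size_tuple => kn; rewrite -hi// -hj'.
have QF A : measurable A -> (Q A = \sum_(k <oo) Q (F k `&` A))%E.
  move=> mA; rewrite -[in LHS](setTI A) -FT setI_bigcupl.
  rewrite measure_semi_bigcup//.
  - by move=> k; exact: measurableI.
  - exact: trivIset_setIr.
  - by apply: bigcupT_measurable => k; exact: measurableI.
rewrite QF; last exact: (measurableI _ _ (mX n z) (mX n.+1 y)).
rewrite [in RHS]QF// muleC -nneseriesZl//; apply: eq_eseriesr => k _.
rewrite /F; case: pickle_inv => [h|]; last by rewrite !set0I measure0 mule0.
pose t i := if (i < n)%N then nth 0 h i else if i == n then z else y.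
have tn : t n = z by rewrite /t ltnn eqxx.
have tn1 : t n.+1 = y by rewrite /t ltnNge leqnSn /= gtn_eqF.
have tlt i : (i < n)%N -> t i = nth 0 h i by rewrite /t => ->.
transitivity (Q [set s | forall i, (i <= n.+1)%N -> X i s = t i]); last first.
  case: chainX => _ _ ->; rewrite tn tn1 muleC; congr (_ * Q _)%E.
  apply/seteqP; split => s /=.
    move=> hs; split; first by move=> i ilt; rewrite hs ?tlt// ltnW.
    by rewrite (hs n).
  move=> [hs Xz] i; rewrite leq_eqVlt => /predU1P[->|ilt]; first by rewrite tn.
  by rewrite tlt// hs.
congr (Q _); apply/seteqP; split => s /=.
  move=> [hs [Xz Xy]] i; rewrite leq_eqVlt => /predU1P[->|]; first by rewrite tn1.
  rewrite ltnS leq_eqVlt => /predU1P[->|ilt]; first by rewrite tn.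
  by rewrite tlt// hs.
move=> hs; split; first by move=> i ilt; rewrite hs ?tlt// leqW// ltnW.
by rewrite (hs n)// (hs n.+1).
Qed.

Lemma markov_chain_heat_kernel n y :
  Q [set s | X n s = y] = (heat_kernel omega n x y)%:E.
Proof.
have [_ X0 _] := chainX.
elim: n y => [|n IH] y.
  rewrite /=; have [<-|xy] := eqVneq x y; first exact: X0.
  apply/eqP; rewrite -measure_le0.
  have := probability_setC Q (mX 0 x); rewrite X0 subee// => <-.
  rewrite le_measure// ?inE//; first exact: measurableC.
  by move=> s /= -> /esym/eqP; rewrite (negbTE xy).
pose A := [set z | neighbor y z].
have fA : finite_set A by exact: finite_neighbor.
pose G z := [set s | X n s = z /\ X n.+1 s = y].
have mG z : measurable (G z) by exact: (measurableI _ _ (mX n z) (mX n.+1 y)).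
have tG B : trivIset B G.
  apply/trivIsetP => i j _ _ /eqP ij; apply/seteqP; split => // s [[Xi _] [Xj _]].
  by apply: ij; rewrite -Xi -Xj.
transitivity (Q (\bigcup_(z in A) G z)).
  apply/eqP; rewrite eq_le; apply/andP; split; last first.
    rewrite le_measure// ?inE//; first exact: fin_bigcup_measurable.
    by move=> s [z _ []].
  pose N := \bigcup_(z in ~` A) G z.
  have mN : measurable N.
    rewrite /N bigcup_mkcond; apply: countable_bigcupT_measurable => // z.
    by case: ifPn.
  have QN : Q N = 0%E.
    apply: measure_negligible => //.
    pose N' (k : nat) := if (pickle_inv k : option (lattice d)) is Some z then
      if neighbor y z then set0 else G z else set0.
    apply: (negligibleS (A := (\bigcup_k N' k))).
      move=> s [z /negP yz Gz]; exists (choice.pickle z) => //.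
      by rewrite /N' pickleK_inv (negbTE yz).
    apply: negligible_bigcup => k; rewrite /N'.
    case: pickle_inv => [z|]; last exact: negligible_set0.
    case: ifPn => yz; first exact: negligible_set0.
    exists (G z); split => //; apply: (etrans (one_step n z y)); rewrite /transition.
    by rewrite neighborC (negbTE yz) mule0.
  rewrite -[leRHS]adde0 -QN.
  apply: (le_trans _ (measureU2 _ _ _)) => //; last exact: fin_bigcup_measurable.
  rewrite le_measure// ?inE//.
    by apply: measurableU => //; exact: fin_bigcup_measurable.
  move=> s /= Xy; have [yz|yz] := boolP (neighbor y (X n s)).
    by left; exists (X n s).
  by right; exists (X n s) => //; exact/negP.
rewrite measure_fin_bigcup//= -fsumEFin//.
by apply: eq_fsbigr => z _; rewrite one_step IH EFinM.
Qed.

End MarkovChain.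

Section Environment.
Context {R : realType} {d : nat} {disp : measure_display}.
Context {T : measurableType disp} (P : probability T R).
Variable omega : {fset lattice d} -> {RV P >-> R}.

Definition origin_in_cluster : set T :=
  [set w | infinite_cluster (fun e => 0 < omega e w) 0].

Lemma measurable_origin_in_cluster : measurable origin_in_cluster.
Proof.
apply: (@measurable_infinite_cluster d disp T (fun e w => 0 < omega e w)).
move=> e _; rewrite (_ : [set _ | _] = omega e @^-1` `]0, +oo[%classic).
  by rewrite -[X in measurable X]setTI; exact: measurable_funP.
by apply/seteqP; split => w /=; rewrite in_itv/= andbT.
Qed.

Definition probability_o : probability T R :=
  cond_probability P measurable_origin_in_cluster.

End Environment.

(* Main.v *)
Require Import Defs.
From HB Require Import structures.
From mathcomp Require Import all_boot all_order all_algebra finmap.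
From mathcomp Require Import all_classical all_reals all_analysis.
From mathcomp Require Import measurable_realfun zify ring lra.

(** Write P for the heat kernel and ||.|| for the l1 norm.  By reversibility and
    the Chapman-Kolmogorov equation,
      P^{2n}(o,o) >= pi(o)/(2d) * sum_x P^n(o,x)^2.
    Let J ~ n^alpha.  If at time n the walk is in the ball of radius 3J with
    probability at least 1/2, the Cauchy-Schwarz inequality already gives a
    return probability of order n^(-d alpha).  Otherwise the walk crosses each
    sphere S_j of radius 3j, j < J, before time n with probability at least 1/2.
    Let h_j(x) be the probability that it first hits S_j at x before time n.
    A trap behind x is a bond of conductance at least xi all of whose 4d-2
    neighboring edges have conductance in [1/n, 2/n]: the walk at x enters it with
    probability of order 1/n and then stays there up to time n with probability
    bounded below.  Hence the traps contribute at least
    c n^-2 sum_j sum_x h_j(x)^2 1[trap behind x] to the sum above.  The function h_j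
    depends only on edges meeting the open ball of radius 3j, and the traps behind
    S_j only on other edges; as sum_x h_j(x)^2 >= c / |S_j|, the normalized
    quantities W_j = sum_x h_j(x)^2 1[trap behind x] / sum_x h_j(x)^2 have conditional
    mean at least p ~ n^(-(4d-2) gamma) given the past.  So
    E[prod_j (1 - W_j/2)] <= (1 - p/2)^J, which is summable since
    (4d-2) gamma < alpha, and by Borel-Cantelli sum_j W_j >= 1 for all large n.
    This gives P^{2n}(o,o) >= c pi(o) n^(-2) n^(-alpha(d-1)). *)

Set Implicit Arguments.
Unset Strict Implicit.
Unset Printing Implicit Defensive.

Import Order.TTheory GRing.Theory Num.Theory.
Import numFieldNormedType.Exports.

Local Open Scope classical_set_scope.
Local Open Scope ring_scope.

(** * Lattice geometry *)

Section Geometry.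
Variable d : nat.
Implicit Types x y z : lattice d.+1.

Definition norm1 x : nat := (\sum_(i < d.+1) absz (x 0%R i))%N.

Lemma norm1_0 : norm1 0 = 0%N.
Proof. by rewrite /norm1 big1// => i _; rewrite mxE. Qed.

Lemma norm1D x y : (norm1 (x + y) <= norm1 x + norm1 y)%N.
Proof.
rewrite /norm1 -big_split/=; apply: leq_sum => i _; rewrite mxE.
by move: (x 0 i) (y 0 i) => a b; lia.
Qed.

Lemma neighborE x y : neighbor x y = (norm1 (x - y) == 1%N).
Proof.
rewrite /neighbor /norm1 -eqz_nat (big_morph Posz PoszD (erefl _)).
by congr (_ == _); apply: eq_bigr => i _; rewrite !mxE abszE.
Qed.

Lemma norm1_neighbor x y : neighbor x y -> (norm1 y <= (norm1 x).+1)%N.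
Proof.
rewrite neighborC neighborE => /eqP xy.
by have := norm1D (y - x) x; rewrite subrK xy.
Qed.

Lemma neighbor_irr x : neighbor x x = false.
Proof. by rewrite neighborE subrr norm1_0. Qed.

Lemma norm1_eq1 x : norm1 x = 1%N ->
  exists i (b : bool), x = (if b then 1 else -1) *: delta_mx 0 i.
Proof.
move=> x1; have [i xi] : exists i, x 0 i != 0.
  apply: contrapT => /forallNP x0; move: x1; rewrite /norm1 big1// => i _.
  by have /negP := x0 i; rewrite negbK => /eqP ->.
move: x1; rewrite /norm1 (bigD1 i)//= => x1.
have xi1 : absz (x 0%R i) = 1%N by lia.
have /eqP : (\sum_(j < d.+1 | j != i) absz (x 0%R j) = 0)%N.
  by move: x1; rewrite xi1 => -[].
rewrite sum_nat_eq0 => /forallP x0.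
exists i, (x 0 i == 1); apply/rowP => j; rewrite !mxE /=.
have [->|ji] := eqVneq j i.
  by rewrite mulr1; case: eqP xi1 => [->//|] ? ?; lia.
by have := x0 j; rewrite ji mulr0 /= absz_eq0 => /eqP.
Qed.

Definition neighbors x : {fset lattice d.+1} := fset_set [set y | neighbor x y].

Lemma in_neighbors x y : (y \in neighbors x) = neighbor x y.
Proof.
rewrite in_fset_set; last exact: finite_neighbor.
by apply/idP/idP; rewrite inE.
Qed.

Lemma card_neighbors x : (#|` neighbors x| <= d.+1.*2)%N.
Proof.
pose g (p : 'I_d.+1 * bool) := x + (if p.2 then 1 else -1) *: delta_mx 0 p.1.
have sub : (neighbors x `<=` [fset g p | p in {: 'I_d.+1 * bool}])%fset.
  apply/fsubsetP => y; rewrite in_neighbors neighborC neighborE => /eqP.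
  move=> /norm1_eq1[i [b yx]]; apply/imfsetP; exists (i, b) => //.
  by rewrite /g/= -yx addrC subrK.
apply: (leq_trans (fsubset_leq_card sub)).
apply: (leq_trans (leq_imfset_card _ _ _)) => /=.
by rewrite -cardE card_prod card_ord card_bool muln2.
Qed.

Lemma finite_ball k : finite_set [set x | (norm1 x <= k)%N].
Proof.
pose g (f : {ffun 'I_d.+1 -> 'I_(k.*2.+1)}) : lattice d.+1 :=
  \row_i ((f i)%:Z - k%:Z).
apply: (@sub_finite_set _ _ (g @` setT)); last exact: finite_image.
move=> x /= xk; have xi i : (absz (x 0%R i) <= k)%N.
  by apply: leq_trans xk; rewrite /norm1 (bigD1 i)//= leq_addr.
exists [ffun i => inord (absz (x 0%R i + k%:Z))] => //.
apply/rowP => i; rewrite !mxE ffunE; have := xi i => ?.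
by rewrite inordK; lia.
Qed.

Definition lball k : {fset lattice d.+1} := fset_set [set x | (norm1 x <= k)%N].

Lemma in_lball k x : (x \in lball k) = (norm1 x <= k)%N.
Proof.
rewrite in_fset_set; last exact: finite_ball.
by apply/idP/idP; rewrite inE.
Qed.

Lemma card_lball k : (#|` lball k| <= (k.*2.+1) ^ d.+1)%N.
Proof.
pose g (f : {ffun 'I_d.+1 -> 'I_(k.*2.+1)}) : lattice d.+1 :=
  \row_i ((f i)%:Z - k%:Z).
have sub : (lball k `<=` [fset g f | f in {: {ffun 'I_d.+1 -> 'I_(k.*2.+1)}}])%fset.
  apply/fsubsetP => x; rewrite in_lball => xk.
  have xi i : (absz (x 0%R i) <= k)%N.
    by apply: leq_trans xk; rewrite /norm1 (bigD1 i)//= leq_addr.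
  apply/imfsetP; exists [ffun i => inord (absz (x 0%R i + k%:Z))] => //.
  apply/rowP => i; rewrite !mxE ffunE; have := xi i => ?.
  by rewrite inordK; lia.
apply: (leq_trans (fsubset_leq_card sub)).
apply: (leq_trans (leq_imfset_card _ _ _)) => /=.
by rewrite -cardE card_ffun !card_ord.
Qed.

Definition lsphere k : {fset lattice d.+1} := [fset x in lball k | norm1 x == k]%fset.

Lemma in_lsphere k x : (x \in lsphere k) = (norm1 x == k).
Proof.
rewrite !inE /= in_lball; apply/andP/eqP => [[_ /eqP//]|->].
by rewrite leqnn eqxx.
Qed.

(* A point of the sphere is determined by its last [d] coordinates and the
   sign of its first one. *)
Lemma card_lsphere k : (#|` lsphere k| <= 2 * k.*2.+1 ^ d)%N.
Proof.
pose g (p : bool * {ffun 'I_d -> 'I_(k.*2.+1)}) : lattice d.+1 :=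
  \row_i if unlift ord0 i is Some j then (p.2 j)%:Z - k%:Z
    else (if p.1 then 1 else -1) *
      (k%:Z - \sum_(j < d) `|(p.2 j)%:Z - k%:Z|).
have sub : (lsphere k `<=`
    [fset g p | p in {: bool * {ffun 'I_d -> 'I_(k.*2.+1)}}])%fset.
  apply/fsubsetP => x; rewrite in_lsphere => /eqP xk.
  have xi i : (absz (x 0%R i) <= k)%N.
    by rewrite -xk /norm1 (bigD1 i)//= leq_addr.
  pose f : {ffun 'I_d -> 'I_(k.*2.+1)} :=
    [ffun j => inord (absz (x 0%R (lift ord0 j) + k%:Z))].
  have fE j : (f j)%:Z - k%:Z = x 0 (lift ord0 j).
    by rewrite ffunE; have := xi (lift ord0 j) => ?; rewrite inordK; lia.
  apply/imfsetP; exists (0 <= x 0 ord0, f) => //.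
  apply/rowP => i; rewrite !mxE /=; case: unliftP => [j ->|->]; first by rewrite fE.
  rewrite (eq_bigr (fun j => (absz (x 0%R (lift ord0 j)))%:Z)); last first.
    by move=> j _; rewrite fE abszE.
  rewrite -(big_morph Posz PoszD (erefl _)).
  move: xk; rewrite /norm1 big_ord_recl /=.
  suff H (u : nat) (a : int) : (absz a + u)%N = k ->
    a = (if 0 <= a then 1 else -1) * (k%:Z - u%:Z) by exact: H.
  by case: ifP; lia.
apply: (leq_trans (fsubset_leq_card sub)).
apply: (leq_trans (leq_imfset_card _ _ _)) => /=.
by rewrite -cardE card_prod card_bool card_ffun !card_ord.
Qed.

(* The sign of the first coordinate does not change, so that [x], [outward x]
   and [outward (outward x)] are aligned and reach increasing norms. *)
Definition outward x : lattice d.+1 :=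
  x + (if 0 <= x 0 ord0 then 1 else -1) *: delta_mx 0 ord0.

Lemma outward0 x :
  outward x 0 ord0 = x 0 ord0 + if 0 <= x 0 ord0 then 1 else -1.
Proof. by rewrite !mxE eqxx mulr1. Qed.

Lemma outwardS x i : outward x 0 (lift ord0 i) = x 0 (lift ord0 i).
Proof. by rewrite !mxE /= mulr0 addr0. Qed.

Lemma norm1_outward x : norm1 (outward x) = (norm1 x).+1.
Proof.
rewrite /norm1 !big_ord_recl outward0; rewrite -addSn.
congr (_ + _)%N; first by case: ifP; lia.
by apply: eq_bigr => i _; rewrite outwardS.
Qed.

Lemma outward_inj : injective outward.
Proof.
move=> x y xy; apply/rowP => i; case: (unliftP ord0 i) => [j ->|->].
  by rewrite -outwardS xy outwardS.
have := congr1 (fun z : lattice d.+1 => z 0 ord0) xy.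
by rewrite !outward0; case: ifP; case: ifP; lia.
Qed.

Lemma neighbor_outward x : neighbor x (outward x).
Proof.
rewrite neighborC neighborE /outward addrC addKr.
rewrite /norm1 big_ord_recl big1 => [|i _].
  by rewrite !mxE /= mulr1; case: ifP.
by rewrite !mxE /= mulr0.
Qed.

(** Only one endpoint has to lie in the open ball. These are the edges that enter the transitions
    out of its points, hence all that the walk stopped on the sphere of radius [k] can see. *)
Definition edges_within k : {fset {fset lattice d.+1}} :=
  fset_set [set e | edges e /\ exists2 x, x \in e & (norm1 x < k)%N].

Definition edges_at x : {fset {fset lattice d.+1}} :=
  [fset [fset x; y]%fset | y in neighbors x]%fset.

Lemma in_edges_at x e : e \in edges_at x -> edges e /\ x \in e.
Proof.
move=> /imfsetP[y /=]; rewrite in_neighbors => xy ->.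
by split; [exact: edges_neighbor|rewrite !inE eqxx].
Qed.

Lemma edge_atP e x : edges e -> x \in e ->
  exists2 y, neighbor x y & e = [fset x; y]%fset.
Proof.
move=> [u [v [uv ->]]]; rewrite !inE => /orP[/eqP->|/eqP->]; first by exists v.
by exists u; rewrite 1?neighborC// fsetUC.
Qed.

Lemma in_edges_within k e : e \in edges_within k <->
  edges e /\ exists2 x, x \in e & (norm1 x < k)%N.
Proof.
suff fin : finite_set [set e : {fset lattice d.+1} |
    edges e /\ exists2 x, x \in e & (norm1 x < k)%N].
  by rewrite in_fset_set//; split; rewrite inE.
apply: (@sub_finite_set _ _
    ((fun p => [fset p.1; p.2]%fset) @` ([set` lball k] `*` [set` lball k.+1]))).
  move=> f [/= ee [x xe xk]]; have [y xy ->] := edge_atP ee xe.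
  exists (x, y) => //=; split => /=; rewrite in_lball; first exact: ltnW.
  by apply: (leq_trans (norm1_neighbor xy)); lia.
by apply: finite_image; apply: finite_setX; exact: finite_fset.
Qed.

Lemma edges_within_edges k e : e \in edges_within k -> edges e.
Proof. by move=> /in_edges_within[]. Qed.

Lemma edges_withinS k l e : (k <= l)%N ->
  e \in edges_within k -> e \in edges_within l.
Proof.
move=> kl /in_edges_within[ee [x xe xk]]; apply/in_edges_within.
by split => //; exists x => //; exact: leq_trans kl.
Qed.

Lemma neighbors_edges_within k x y : (norm1 x < k)%N -> neighbor x y ->
  [fset x; y]%fset \in edges_within k.
Proof.
move=> xk xy; apply/in_edges_within; split; first exact: edges_neighbor.
by exists x => //; rewrite !inE eqxx.
Qed.

(** Starting one step beyond [x] keeps every edge at either end of the bond outside the open ball of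
    radius [norm1 x], while the walk at [x] enters in one step. *)
Definition trap_bond x : {fset lattice d.+1} :=
  [fset outward x; outward (outward x)]%fset.

Definition trap_edges x : {fset {fset lattice d.+1}} :=
  (edges_at (outward x) `|` edges_at (outward (outward x)))%fset.

Lemma trap_edges_edges x e : e \in trap_edges x -> edges e.
Proof. by rewrite !inE => /orP[] /in_edges_at[]. Qed.

Lemma edges_trap_bond x : edges (trap_bond x).
Proof. exact/edges_neighbor/neighbor_outward. Qed.

Lemma trap_bond_trap_edges x : trap_bond x \in trap_edges x.
Proof.
rewrite inE; apply/orP; left; apply/imfsetP.
by exists (outward (outward x)) => //=; rewrite in_neighbors neighbor_outward.
Qed.

Lemma edge_trap_edges x y : neighbor (outward x) y ->
  [fset outward x; y]%fset \in trap_edges x.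
Proof.
move=> xy; rewrite inE; apply/orP; left; apply/imfsetP.
by exists y => //=; rewrite in_neighbors.
Qed.

Lemma edge2_trap_edges x y : neighbor (outward (outward x)) y ->
  [fset outward (outward x); y]%fset \in trap_edges x.
Proof.
move=> xy; rewrite inE; apply/orP; right; apply/imfsetP.
by exists y => //=; rewrite in_neighbors.
Qed.

Lemma card_edges_atD1 x y : neighbor x y ->
  (#|` (edges_at x `\ [fset x; y])%fset| <= d.*2.+1)%N.
Proof.
move=> xy.
have sub : (edges_at x `\ [fset x; y]%fset `<=`
    [fset [fset x; z]%fset | z in (neighbors x `\ y)%fset])%fset.
  apply/fsubsetP => e; rewrite in_fsetD1 => /andP[ne] /imfsetP[z /= zx ez].
  apply/imfsetP; exists z => //=; rewrite in_fsetD1 zx andbT.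
  by apply: contra ne => /eqP zy; rewrite ez zy.
apply: (leq_trans (fsubset_leq_card sub)).
apply: (leq_trans (leq_imfset_card _ _ _)) => /=.
have := card_neighbors x; rewrite (cardfsD1 y) in_neighbors xy /=.
by rewrite -[size _]/(#|` _|); lia.
Qed.

(** The dimension is [d.+1], so each end of the bond has at most [2 * d + 1] edges besides the bond.
    In terms of the dimension the total is the [4d - 2] of the theorem. *)
Lemma card_trap_edges x :
  (#|` (trap_edges x `\ trap_bond x)%fset| <= 4 * d + 2)%N.
Proof.
rewrite fsetDUl; apply: (@leq_trans (#|` edges_at (outward x) `\ trap_bond x| +
  #|` edges_at (outward (outward x)) `\ trap_bond x|)%N%fset).
  by rewrite cardfsU leq_subr.
have h1 := card_edges_atD1 (neighbor_outward (outward x)).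
have h2 : (#|` (edges_at (outward (outward x)) `\ trap_bond x)%fset| <= d.*2.+1)%N.
  by rewrite /trap_bond fsetUC; apply: card_edges_atD1;
    rewrite neighborC neighbor_outward.
by rewrite -/(trap_bond x) in h1; lia.
Qed.

(** Such an edge has an endpoint of norm [k.+1] or [k.+2], so its other endpoint has norm at least
    [k]. This is why the spheres are taken at multiples of 3: the traps of one sphere are already
    edges of the next ball. *)
Lemma trap_edges_fresh x k e : norm1 x = k -> e \in trap_edges x ->
  e \in edges_within k.+3 /\ e \notin edges_within k.
Proof.
move=> xk ex.
have [y ye yk] : exists2 y, y \in e & ((k < norm1 y)%N && (norm1 y < k.+3)%N).
  move: ex; rewrite inE => /orP[] /in_edges_at[_ ?];
    [exists (outward x)|exists (outward (outward x))] => //;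
    by rewrite !norm1_outward xk; lia.
have ee := trap_edges_edges ex; split.
  by apply/in_edges_within; split => //; exists y => //; lia.
apply/negP => /in_edges_within[_ [z ze zk]].
have [u yu eE] := edge_atP ee ye; move: ze; rewrite eE !inE => /orP[] /eqP zE.
  by move: zk; rewrite zE; lia.
have := norm1_neighbor (x := u) (y := y); rewrite neighborC yu -zE; lia.
Qed.

End Geometry.

(** * The quenched walk and its traps *)

Section SeqSums.
Variable R : realType.

Lemma ler_sum_uniq_sub (I : choiceType) (s t : seq I) (F : I -> R) :
  uniq s -> {subset s <= t} -> (forall i, 0 <= F i) ->
  \sum_(i <- s) F i <= \sum_(i <- t) F i.
Proof.
move=> + + F0; elim: s t => [|a s IH] t /=.
  by move=> _ _; rewrite big_nil sumr_ge0.
move=> /andP[sa us] st; have ta : a \in t by apply: st; rewrite mem_head.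
rewrite big_cons (perm_big _ (perm_to_rem ta)) big_cons lerD2l IH// => i si.
have := perm_mem (perm_to_rem ta) i; rewrite st ?inE ?si ?orbT//.
by case: eqVneq si sa => [->->//|].
Qed.

Lemma sumr_fset_delta (I : choiceType) (A : {fset I}) (a : I) (F : I -> R) :
  \sum_(i <- A) (i == a)%:R * F i = if a \in A then F a else 0.
Proof.
case: ifPn => aA.
  rewrite (big_fsetD1 a)//= eqxx mul1r big_seq_cond big1 ?addr0// => i.
  by rewrite !inE => /andP[/andP[/negbTE->]]; rewrite mul0r.
rewrite big_seq_cond big1// => i /andP[iA _].
by case: eqVneq iA aA => [->->//|]; rewrite mul0r.
Qed.

(** Cauchy-Schwarz in tangent form: [F i ^+ 2] is at least [2 * a * F i - a ^+ 2], and
    [a = (2 * N)^-1] is the optimal slope when [A] has [N] points. *)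
Lemma sum_sqr_ge (I : choiceType) (A : {fset I}) (F : I -> R) (N : R) :
  0 < N -> #|` A|%:R <= N -> 2^-1 <= \sum_(i <- A) F i ->
  (4 * N)^-1 <= \sum_(i <- A) F i ^+ 2.
Proof.
move=> N0 AN F2; set a := (2 * N)^-1.
have a0 : 0 < a by rewrite invr_gt0 mulr_gt0.
have : \sum_(i <- A) (2 * a * F i - a ^+ 2) <= \sum_(i <- A) F i ^+ 2.
  by apply: ler_sum => i _; have := sqr_ge0 (F i - a); nra.
apply: le_trans; rewrite sumrB -mulr_sumr big_const_seq count_predT iter_addr_0.
have h1 : a ^+ 2 *+ size A <= a / 2.
  have -> : a / 2 = a ^+ 2 * N by rewrite /a; field; rewrite gt_eqF.
  by rewrite -mulr_natr ler_wpM2l// sqr_ge0.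
have -> : (4 * N)^-1 = a / 2 by rewrite /a; field; rewrite gt_eqF.
by nra.
Qed.

Lemma prod_one_minus_ge (n : nat) (F : nat -> R) :
  (forall i, 0 <= F i <= 1) -> 1 - \sum_(i < n) F i <= \prod_(i < n) (1 - F i).
Proof.
move=> F01; elim: n => [|n IH]; first by rewrite !big_ord0 subr0.
rewrite !big_ord_recr/=; have /andP[f0 f1] := F01 n.
have : 0 <= \sum_(i < n) F i by apply: sumr_ge0 => i _; have /andP[] := F01 i.
by nra.
Qed.

End SeqSums.

(** * Reversibility, hitting probabilities and lower bounds for the heat kernel in a fixed
    environment *)

Section Walk.
Variables (R : realType) (d : nat) (w : {fset lattice d.+1} -> R).
Implicit Types x y z : lattice d.+1.

Local Notation D := (d.+1.*2%:R : R).

Lemma conductance_sumE x :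
  conductance_sum w x = \sum_(y <- neighbors x) w [fset x; y]%fset.
Proof. by rewrite /conductance_sum fsbig_finite//; exact: finite_neighbor. Qed.

Lemma heat_kernelS n x y : heat_kernel w n.+1 x y =
  \sum_(z <- neighbors y) heat_kernel w n x z * transition w z y.
Proof. by rewrite /= fsbig_finite//; exact: finite_neighbor. Qed.

(* The walk from the origin is killed after leaving the open ball of radius [k]:
   when [norm1 y = k], [killed_kernel k t y] is the probability that it first
   hits the sphere of radius [k] at time [t] and at [y]. *)
Fixpoint killed_kernel k t y : R :=
  if t is t'.+1 then
    \sum_(z <- lball d k | (norm1 z < k)%N)
      killed_kernel k t' z * transition w z y
  else (y == 0)%:R.

Definition hitting k n x : R := \sum_(s < n) killed_kernel k s x.

Definition is_trap (xi u : R) x : bool :=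
  (xi <= w (trap_bond x)) &&
  all (fun e => u <= w e <= 2 * u) (trap_edges x `\ trap_bond x)%fset.

Definition hitting2 k n : R := \sum_(x <- lsphere d k) hitting k n x ^+ 2.

(* The default value makes the weights add up to 1 in all cases. *)
Definition weight k n x : R :=
  if hitting2 k n == 0 then (x == k%:Z *: delta_mx 0 0)%:R
  else hitting k n x ^+ 2 / hitting2 k n.

Definition trap_weight xi u k n : R :=
  \sum_(x <- lsphere d k) weight k n x * (is_trap xi u x)%:R.

Hypothesis w01 : forall e, edges e -> 0 <= w e <= 1.

Let w0 x y : neighbor x y -> 0 <= w [fset x; y]%fset.
Proof. by move=> /edges_neighbor/w01/andP[]. Qed.

Lemma conductance_sum_ge0 x : 0 <= conductance_sum w x.
Proof.
rewrite conductance_sumE big_seq sumr_ge0// => y.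
by rewrite in_neighbors; exact: w0.
Qed.

Lemma conductance_le_sum x y : neighbor x y ->
  w [fset x; y]%fset <= conductance_sum w x.
Proof.
move=> xy; rewrite conductance_sumE (big_fsetD1 y) ?in_neighbors//= lerDl.
rewrite big_seq sumr_ge0// => z; rewrite in_fsetD1 in_neighbors => /andP[_].
exact: w0.
Qed.

Lemma conductance_sum_le x : conductance_sum w x <= D.
Proof.
rewrite conductance_sumE.
have : \sum_(y <- neighbors x) w [fset x; y]%fset <= \sum_(y <- neighbors x) 1.
  rewrite big_seq [leRHS]big_seq; apply: ler_sum => y.
  by rewrite in_neighbors => /edges_neighbor/w01/andP[].
move=> /le_trans; apply; rewrite big_const_seq count_predT iter_addr_0.
by rewrite ler_nat; exact: card_neighbors.
Qed.

Lemma transition_ge0 x y : 0 <= transition w x y.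
Proof.
rewrite /transition; case: ifPn => // xy.
by rewrite divr_ge0 ?conductance_sum_ge0 ?w0.
Qed.

(** This holds at isolated sites too: if the sum at [x] vanishes, so does each of its nonnegative
    terms. *)
Lemma conductance_transition x y : conductance_sum w x * transition w x y =
  if neighbor x y then w [fset x; y]%fset else 0.
Proof.
rewrite /transition; case: ifPn => xy; last by rewrite mulr0.
have [x0|x0] := eqVneq (conductance_sum w x) 0; last by field.
by apply/eqP; rewrite x0 mul0r eq_le w0//= -x0 conductance_le_sum.
Qed.

Lemma transition_reversible x y : conductance_sum w x * transition w x y =
  conductance_sum w y * transition w y x.
Proof. by rewrite !conductance_transition neighborC fsetUC. Qed.

Lemma transition_mass x : conductance_sum w x != 0 ->
  \sum_(y <- neighbors x) transition w x y = 1.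
Proof.
move=> x0; apply: (mulfI x0); rewrite mulr1 mulr_sumr conductance_sumE.
rewrite big_seq [RHS]big_seq; apply: eq_bigr => y; rewrite in_neighbors => xy.
by rewrite -conductance_sumE conductance_transition xy.
Qed.

Lemma sum_transition_le (s : seq (lattice d.+1)) (Q : pred (lattice d.+1))
    (F : lattice d.+1 -> R) y :
  uniq s -> (forall z, 0 <= F z) ->
  \sum_(z <- s | Q z) F z * transition w z y <=
  \sum_(z <- neighbors y) F z * transition w z y.
Proof.
move=> us F0; rewrite (bigID (fun z => neighbor y z))/=.
rewrite [X in _ + X]big1 ?addr0 => [|z /andP[_]]; last first.
  by rewrite neighborC /transition => /negbTE ->; rewrite mulr0.
rewrite -big_filter; apply: ler_sum_uniq_sub.
- exact: filter_uniq.
- by move=> z; rewrite mem_filter in_neighbors => /andP[/andP[]].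
- by move=> z; rewrite mulr_ge0// transition_ge0.
Qed.

Lemma heat_kernel_ge0 n x y : 0 <= heat_kernel w n x y.
Proof.
elim: n y => [|n IH] y; first exact: ler0n.
by rewrite heat_kernelS sumr_ge0// => z _; rewrite mulr_ge0// transition_ge0.
Qed.

Lemma heat_kernel_first_step n x y : heat_kernel w n.+1 x y =
  \sum_(z <- neighbors x) transition w x z * heat_kernel w n z y.
Proof.
elim: n y => [|n IH] y.
  rewrite heat_kernelS /=.
  under eq_bigr do rewrite eq_sym.
  under [RHS]eq_bigr do rewrite mulrC.
  rewrite !sumr_fset_delta !in_neighbors neighborC; case: ifP => // xy.
rewrite heat_kernelS; under eq_bigr do rewrite IH mulr_suml.
rewrite exchange_big; apply: eq_bigr => z _.
by rewrite heat_kernelS mulr_sumr; apply: eq_bigr => v _; rewrite mulrA.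
Qed.

(** Detailed balance turns the decomposition at the last step into the decomposition at the first
    step. *)
Lemma heat_kernel_reversible n x y :
  conductance_sum w x * heat_kernel w n x y =
  conductance_sum w y * heat_kernel w n y x.
Proof.
elim: n x y => [|n IH] x y.
  by rewrite /= [y == x]eq_sym; case: eqVneq => [->//|]; rewrite !mulr0.
rewrite heat_kernelS heat_kernel_first_step !mulr_sumr; apply: eq_bigr => z _.
by rewrite mulrA IH mulrA -transition_reversible mulrAC.
Qed.

Lemma heat_kernel_chapman (A : {fset lattice d.+1}) m n x y :
  \sum_(z <- A) heat_kernel w m x z * heat_kernel w n z y <=
  heat_kernel w (m + n) x y.
Proof.
elim: n y => [|n IH] y.
  rewrite addn0 /=; under eq_bigr do rewrite mulrC.
  by rewrite sumr_fset_delta; case: ifP => // _; exact: heat_kernel_ge0.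
rewrite addnS heat_kernelS; under eq_bigr do rewrite heat_kernelS mulr_sumr.
rewrite exchange_big/=; apply: ler_sum => z _.
rewrite (le_trans _ (ler_wpM2r (transition_ge0 _ _) (IH z)))// mulr_suml.
by apply: ler_sum => v _; rewrite mulrA.
Qed.

(** By reversibility the return probability from [z] is [conductance_sum w 0 / conductance_sum w z]
    times [heat_kernel w n 0 z] where the denominator is nonzero, and a total conductance is at most
    [D]. Chapman-Kolmogorov then produces the squares. *)
Lemma heat_kernel_diag_ge (A : {fset lattice d.+1}) n :
  conductance_sum w 0 / D * \sum_(z <- A) heat_kernel w n 0 z ^+ 2 <=
  heat_kernel w n.*2 0 0.
Proof.
rewrite -[n.*2]addnn; apply: le_trans (heat_kernel_chapman A n n 0 0).
rewrite mulr_sumr; apply: ler_sum => z _.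
rewrite mulrAC expr2 mulrA heat_kernel_reversible.
rewrite ler_pdivrMr ?ltr0n// -mulrA [leRHS]mulrC [X in _ * X]mulrC.
by rewrite ler_wpM2r ?conductance_sum_le// mulr_ge0// heat_kernel_ge0.
Qed.

Lemma killed_kernel_ge0 k t y : 0 <= killed_kernel k t y.
Proof.
elim: t y => [|t IH] y; first exact: ler0n.
by rewrite sumr_ge0// => z _; rewrite mulr_ge0// transition_ge0.
Qed.

Lemma killed_kernel_le k t y : killed_kernel k t y <= heat_kernel w t 0 y.
Proof.
elim: t y => [|t IH] y; first by rewrite /= eq_sym.
rewrite heat_kernelS /=.
apply: le_trans (@sum_transition_le (lball d k) (fun z => norm1 z < k)%N _ _ _ _); last 2 first.
- exact: fset_uniq.
- by move=> z; exact: heat_kernel_ge0.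
- by apply: ler_sum => z _; rewrite ler_wpM2r ?transition_ge0 ?IH.
Qed.

Lemma hitting_ge0 k n x : 0 <= hitting k n x.
Proof. by apply: sumr_ge0 => s _; exact: killed_kernel_ge0. Qed.

(** Transitions out of an isolated site have total mass 0 instead of 1, so conservation of mass
    requires that the walk never visits one. *)
Lemma killed_kernel_isolated k t y : conductance_sum w 0 != 0 ->
  conductance_sum w y = 0 -> killed_kernel k t y = 0.
Proof.
move=> o0 y0; case: t => [|t] /=.
  by case: eqVneq => // yE; rewrite -yE y0 eqxx in o0.
apply: big1 => z _; have := transition_reversible z y.
rewrite conductance_transition y0 mul0r /transition.
by case: ifP => _ ->; rewrite ?mul0r mulr0.
Qed.

Lemma lball_split k (F : lattice d.+1 -> R) : \sum_(x <- lball d k) F x =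
  \sum_(x <- lball d k | (norm1 x < k)%N) F x + \sum_(x <- lsphere d k) F x.
Proof.
rewrite (bigID (fun x => norm1 x < k)%N)/=; congr (_ + _).
rewrite -big_filter -[RHS]big_filter; apply: perm_big; apply: uniq_perm.
- by rewrite filter_uniq// fset_uniq.
- by rewrite filter_uniq// fset_uniq.
- move=> x; rewrite !mem_filter/= in_lsphere in_lball -leqNgt andbC.
  by rewrite -eqn_leq eq_sym.
Qed.

(** Mass on the sphere at time [t] still counts in the first sum; at time [t.+1] it has left the
    killed walk and is the new term [s = t] of [hitting]. Mass in the open ball is redistributed
    over the closed ball. *)
Lemma killed_kernel_mass k t : conductance_sum w 0 != 0 ->
  \sum_(y <- lball d k) killed_kernel k t y +
  \sum_(x <- lsphere d k) hitting k t x = 1.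
Proof.
move=> o0; elim: t => [|t <-].
  rewrite [X in _ + X]big1 ?addr0 => [|x _]; last by rewrite /hitting big_ord0.
  under eq_bigr do rewrite -[killed_kernel _ _ _]mulr1 /=.
  by rewrite sumr_fset_delta in_lball norm1_0.
have -> : \sum_(y <- lball d k) killed_kernel k t.+1 y =
    \sum_(z <- lball d k | (norm1 z < k)%N) killed_kernel k t z.
  rewrite /= exchange_big/=; apply: eq_bigr => z zk; rewrite -mulr_sumr.
  have [z0|z0] := eqVneq (conductance_sum w z) 0.
    by rewrite killed_kernel_isolated// mul0r.
  rewrite -[RHS]mulr1 -(transition_mass z0); congr (_ * _).
  rewrite [LHS](bigID (fun y => neighbor z y))/= [X in _ + X]big1 ?addr0.
    rewrite -big_filter; apply: perm_big; apply: uniq_perm; rewrite ?filter_uniq ?fset_uniq//.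
    move=> y; rewrite mem_filter in_neighbors in_lball; apply: andb_idr.
    by move=> /norm1_neighbor/leq_trans; apply.
  by move=> y /negbTE yz; rewrite /transition yz.
rewrite lball_split -addrA; congr (_ + _); rewrite -big_split/=.
by apply: eq_bigr => x _; rewrite /hitting big_ord_recr/= addrC.
Qed.

(** Whatever has not been absorbed before time [n] sits in the ball of radius [k], where the killed
    kernel is dominated by the heat kernel. *)
Lemma hitting_mass k M n : conductance_sum w 0 != 0 -> (k <= M)%N ->
  \sum_(z <- lball d M) heat_kernel w n 0 z < 2^-1 ->
  2^-1 <= \sum_(x <- lsphere d k) hitting k n x.
Proof.
move=> o0 kM HM; have := killed_kernel_mass k n o0.
have : \sum_(y <- lball d k) killed_kernel k n y <=
    \sum_(z <- lball d M) heat_kernel w n 0 z; last by lra.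
apply: (@le_trans _ _ (\sum_(y <- lball d k) heat_kernel w n 0 y)).
  by apply: ler_sum => y _; exact: killed_kernel_le.
apply: ler_sum_uniq_sub => [|y|y]; rewrite ?heat_kernel_ge0 ?fset_uniq//.
by rewrite !in_lball => /leq_trans; apply.
Qed.

(** * Entering a trap and staying in it *)

Section Trap.
Variables (xi u : R) (x : lattice d.+1).
Hypotheses (xi0 : 0 < xi) (u0 : 0 < u) (trapx : is_trap xi u x).

Let y := outward x.
Let z := outward y.
Let rho := xi / (xi + 2 * D * u).

Let xi_le : xi <= w (trap_bond x). Proof. by case/andP: trapx. Qed.

Let trapE e : e \in trap_edges x -> e != trap_bond x -> u <= w e <= 2 * u.
Proof.
by case/andP: trapx => _ /allP h et ne; apply: h; rewrite in_fsetD1 ne.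
Qed.

(** At an end of the bond the other edges carry at most [2 * D * u] altogether. The share of the
    bond increases with its conductance, so the worst case is [xi], which gives [rho]. *)
Let hold a b : neighbor a b -> trap_bond x = [fset a; b]%fset ->
  (forall c, neighbor a c -> [fset a; c]%fset \in trap_edges x) ->
  rho <= transition w a b.
Proof.
move=> ab tE tin; rewrite /transition ab -tE.
have le : conductance_sum w a <= w (trap_bond x) + 2 * D * u.
  rewrite conductance_sumE (big_fsetD1 b) ?in_neighbors//= -tE lerD2l.
  apply: (@le_trans _ _ (\sum_(c <- (neighbors a `\ b)%fset) (2 * u))).
    rewrite big_seq [leRHS]big_seq; apply: ler_sum => c.
    rewrite in_fsetD1 in_neighbors => /andP[cb ac].
    have [|] := boolP ([fset a; c]%fset == trap_bond x); last first.
      by move=> /(trapE (tin c ac))/andP[].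
    rewrite tE => /eqP.
    move=> /fsetP /(_ c); rewrite !inE eqxx orbT (negbTE cb) orbF.
    by move=> /esym/eqP ca; rewrite ca neighbor_irr in ac.
  rewrite big_const_seq count_predT iter_addr_0.
  rewrite -[leLHS]mulr_natr mulrAC.
  rewrite ler_wpM2r ?(ltW u0)// ler_wpM2l// ler_nat.
  by apply: leq_trans (card_neighbors a); rewrite [leqRHS](cardfsD1 b) leq_addl.
have D0 : 0 < D by rewrite ltr0n.
have W0 : 0 < w (trap_bond x) by exact: lt_le_trans xi_le.
have pa : 0 < conductance_sum w a.
  by apply: lt_le_trans W0 _; rewrite tE conductance_le_sum.
have b0 : 0 < 2 * D * u by rewrite !mulr_gt0.
rewrite ler_pdivlMr// mulrAC ler_pdivrMr ?addr_gt0//.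
move: le b0; set b' := 2 * _ * u; move: W0 xi_le xi0; nra.
Qed.

(* One step keeps the walk on the trap bond with probability at least [rho],
   and brings it from [x] into the trap with probability at least [u / D]. *)
Lemma trap_heat_kernel_step k t :
  rho * (heat_kernel w t 0 y + heat_kernel w t 0 z) +
    u / D * killed_kernel k t x <=
  heat_kernel w t.+1 0 y + heat_kernel w t.+1 0 z.
Proof.
have xy := neighbor_outward x; have yz := neighbor_outward y.
have ryz : rho <= transition w y z.
  by apply: hold => // c; exact: edge_trap_edges.
have rzy : rho <= transition w z y.
  apply: hold; rewrite 1?neighborC//; first by rewrite fsetUC.
  by move=> c; exact: edge2_trap_edges.
have nxz : x != z.
  by apply/eqP => /(congr1 (@norm1 d)); rewrite !norm1_outward; lia.
have uxy : u / D <= transition w x y.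
  rewrite /transition xy.
  have ux : u <= w [fset x; y]%fset.
    have xin : [fset x; y]%fset \in trap_edges x.
      by rewrite fsetUC; apply: edge_trap_edges; rewrite neighborC.
    suff /(trapE xin)/andP[] : [fset x; y]%fset != trap_bond x by [].
    apply/eqP => /fsetP /(_ x).
    rewrite !inE eqxx /= => /esym /orP[] /eqP xE; last by move: nxz; rewrite {1}xE eqxx.
    by move: xy; rewrite {1}xE neighbor_irr.
  have px : 0 < conductance_sum w x.
    by apply: lt_le_trans u0 (le_trans ux (conductance_le_sum xy)).
  rewrite ler_pdivlMr// mulrAC ler_pdivrMr ?ltr0n//.
  by rewrite ler_pM ?conductance_sum_le// ltW.
have h0 := heat_kernel_ge0 t 0.
have hy : heat_kernel w t 0 x * transition w x y +
    heat_kernel w t 0 z * transition w z y <= heat_kernel w t.+1 0 y.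
  rewrite heat_kernelS.
  have := @sum_transition_le [:: x; z] xpredT (heat_kernel w t 0) y.
  by rewrite !big_cons big_nil addr0; apply => //=; rewrite inE nxz.
have hz : heat_kernel w t 0 y * transition w y z <= heat_kernel w t.+1 0 z.
  rewrite heat_kernelS.
  have := @sum_transition_le [:: y] xpredT (heat_kernel w t 0) z.
  by rewrite !big_cons big_nil addr0; apply.
have hx : u / D * killed_kernel k t x <= heat_kernel w t 0 x * transition w x y.
  rewrite mulrC ler_pM ?killed_kernel_ge0 ?killed_kernel_le//.
  by rewrite divr_ge0 ?ler0n// ltW.
have := ler_wpM2l (h0 z) rzy; have := ler_wpM2l (h0 y) ryz.
by move: hx hy hz; lra.
Qed.

(** An arrival at [x] at time [s < n] pays [u / D] to enter and then [n - s - 1] factors [rho] to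
    stay. Since [rho <= 1], the factor [rho ^+ n] serves all arrival times at once. *)
Lemma trap_heat_kernel_ge k n :
  rho ^+ n * (u / D) * hitting k n x <=
  heat_kernel w n 0 y + heat_kernel w n 0 z.
Proof.
have D0 : 0 < D by rewrite ltr0n.
have b0 : 0 < 2 * D * u by rewrite !mulr_gt0.
have rho0 : 0 <= rho by rewrite divr_ge0 ?addr_ge0 ?ltW.
have rho1 : rho <= 1 by rewrite ler_pdivrMr ?addr_gt0// mul1r lerDl ltW.
have uD : 0 < u / D by rewrite divr_gt0.
elim: n => [|n IH].
  by rewrite /hitting big_ord0 mulr0 addr_ge0 ?heat_kernel_ge0.
apply: le_trans (trap_heat_kernel_step k n).
rewrite /hitting big_ord_recr/= -/(hitting k n x) mulrDr lerD//.
  by rewrite exprS -!(mulrA rho) ler_wpM2l// mulrA.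
rewrite -mulrA ler_piMl ?exprn_ile1//.
by rewrite mulr_ge0 ?killed_kernel_ge0// ltW.
Qed.

End Trap.

(** With [u = n%:R^-1], the inverse of [rho] is [1 + 2 * D / xi / n%:R], whose [n]-th power is at
    most [expR (2 * D / xi)]: the cost of staying is bounded uniformly in [n]. The factor [2^-1]
    comes from splitting the square of a sum of two terms. *)
Lemma trap_heat_kernel_sqr_ge (xi : R) x k n : 0 < xi -> (0 < n)%N ->
  is_trap xi n%:R^-1 x ->
  2^-1 * (expR (- (2 * D / xi)) / D * n%:R^-1 * hitting k n x) ^+ 2 <=
  heat_kernel w n 0 (outward x) ^+ 2 +
  heat_kernel w n 0 (outward (outward x)) ^+ 2.
Proof.
move=> xi0 n0 tr; have n0' : 0 < n%:R :> R by rewrite ltr0n.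
have D0 : 0 < D by rewrite ltr0n.
have := @trap_heat_kernel_ge xi n%:R^-1 x xi0 _ tr k n.
rewrite invr_gt0 => /(_ n0'); set rho := xi / _ => le.
have rhoE : expR (- (2 * D / xi)) <= rho ^+ n.
  have -> : rho = (1 + 2 * D / xi / n%:R)^-1.
    by rewrite /rho; field; rewrite !gt_eqF//= addr_gt0// !mulr_gt0 ?divr_gt0.
  have q0 : 0 <= 2 * D / xi / n%:R by rewrite !divr_ge0 ?mulr_ge0 ?ltW.
  rewrite expRN exprVn lef_pV2 ?posrE ?expR_gt0 ?exprn_gt0 ?ltr_wpDr//.
  apply: (@le_trans _ _ (expR (2 * D / xi / n%:R) ^+ n)).
    by rewrite lerXn2r ?nnegrE ?expR_ge0 ?addr_ge0 ?expR_ge1Dx.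
  by rewrite -expRM_natl mulrC divfK ?gt_eqF.
set a := heat_kernel _ _ _ _ in le *; set b := heat_kernel _ _ _ _ in le *.
have a0 : 0 <= a by exact: heat_kernel_ge0.
have b0 : 0 <= b by exact: heat_kernel_ge0.
set q := expR _ / _ * _ * _.
have q0 : 0 <= q.
  by rewrite !mulr_ge0 ?hitting_ge0 ?invr_ge0 ?expR_ge0 ?ltW.
have qab : q <= a + b.
  apply: le_trans le; rewrite (_ : q = expR (- (2 * D / xi)) *
    (n%:R^-1 / D) * hitting k n x); last first.
    by rewrite /q; congr (_ * _); rewrite mulrA mulrAC.
  by rewrite !ler_wpM2r ?hitting_ge0// divr_ge0 ?invr_ge0 ?ltW.
by have := sqr_ge0 (a - b); nra.
Qed.

Lemma sum_lballS k (F : lattice d.+1 -> R) : \sum_(x <- lball d k.+1) F x =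
  \sum_(x <- lball d k) F x + \sum_(x <- lsphere d k.+1) F x.
Proof.
rewrite lball_split; congr (_ + _); rewrite -big_filter; apply: perm_big.
apply: uniq_perm; rewrite ?filter_uniq ?fset_uniq// => x.
by rewrite mem_filter !in_lball ltnS; apply: andb_idr => /leqW.
Qed.

Lemma sum_outward_le k (F : lattice d.+1 -> R) : (forall x, 0 <= F x) ->
  \sum_(x <- lsphere d k) F (outward x) <= \sum_(x <- lsphere d k.+1) F x.
Proof.
move=> F0; rewrite -(big_map _ xpredT F); apply: ler_sum_uniq_sub => //.
  by rewrite map_inj_uniq ?fset_uniq//; exact: outward_inj.
move=> _ /mapP[x + ->]; rewrite !in_lsphere => /eqP xk.
by rewrite norm1_outward xk.
Qed.

(** The map [outward] is injective and raises the norm by 1, so the trap ends behind the sphere of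
    radius [3 * j] lie on the spheres of radii [3 * j + 1] and [3 * j + 2], and no point is counted
    twice. *)
Lemma sum_traps_le J (F : lattice d.+1 -> R) : (forall x, 0 <= F x) ->
  \sum_(j < J) \sum_(x <- lsphere d (3 * j))
    (F (outward x) + F (outward (outward x))) <=
  \sum_(x <- lball d (3 * J)) F x.
Proof.
move=> F0; elim: J => [|J IH]; first by rewrite big_ord0 sumr_ge0.
rewrite big_ord_recr/= mulnS addnC addn3 !sum_lballS -!addrA lerD// big_split/=.
have h1 := sum_outward_le (3 * J) F0.
have h2 := sum_outward_le (3 * J) (fun x => F0 (outward x)).
have h3 := sum_outward_le (3 * J).+1 F0.
have h4 : 0 <= \sum_(x <- lsphere d (3 * J).+3) F x by exact: sumr_ge0.
by move: h1 h2 h3 h4; rewrite /=; lra.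
Qed.

Lemma hitting2_trap_weight xi u k n : hitting2 k n != 0 ->
  hitting2 k n * trap_weight xi u k n =
  \sum_(x <- lsphere d k) (is_trap xi u x)%:R * hitting k n x ^+ 2.
Proof.
move=> h0; rewrite /trap_weight mulr_sumr; apply: eq_bigr => x _.
by rewrite /weight (negbTE h0) mulrA mulrCA divff// mulr1 mulrC.
Qed.

Lemma weight_ge0 k n x : 0 <= weight k n x.
Proof.
rewrite /weight; case: ifP => _; first exact: ler0n.
by rewrite divr_ge0 ?sqr_ge0// sumr_ge0// => y _; exact: sqr_ge0.
Qed.

Lemma sum_weight k n : \sum_(x <- lsphere d k) weight k n x = 1.
Proof.
rewrite /weight; case: eqVneq => [_|h0]; last by rewrite -mulr_suml divff.
under eq_bigr do rewrite -[X in X%:R]/(nat_of_bool _) -[_%:R]mulr1.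
rewrite sumr_fset_delta in_lsphere; case: eqP => // -[].
rewrite /norm1 big_ord_recl big1 => [|i _]; first by rewrite !mxE mulr1 addn0.
by rewrite !mxE /=; lia.
Qed.

Lemma trap_weight_ge0 xi u k n : 0 <= trap_weight xi u k n.
Proof. by rewrite sumr_ge0// => x _; rewrite mulr_ge0 ?weight_ge0. Qed.

Lemma trap_weight_le1 xi u k n : trap_weight xi u k n <= 1.
Proof.
rewrite -(sum_weight k n); apply: ler_sum => x _.
by rewrite ler_piMr ?weight_ge0// lern1 leq_b1.
Qed.

Lemma heat_kernel_confined n (A : {fset lattice d.+1}) (N : R) :
  0 < N -> #|` A|%:R <= N -> 2^-1 <= \sum_(x <- A) heat_kernel w n 0 x ->
  conductance_sum w 0 / D * (4 * N)^-1 <= heat_kernel w n.*2 0 0.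
Proof.
move=> N0 AN A2; apply: le_trans (heat_kernel_diag_ge A n).
by rewrite ler_wpM2l ?sum_sqr_ge// divr_ge0 ?conductance_sum_ge0.
Qed.

Lemma heat_kernel_trapped (xi : R) n J (N : R) :
  0 < xi -> (0 < n)%N -> 0 < N ->
  (forall j, (j < J)%N -> #|` lsphere d (3 * j)|%:R <= N) ->
  conductance_sum w 0 != 0 ->
  \sum_(x <- lball d (3 * J)) heat_kernel w n 0 x < 2^-1 ->
  1 <= \sum_(j < J) trap_weight xi n%:R^-1 (3 * j) n ->
  conductance_sum w 0 / D *
    ((expR (- (2 * D / xi)) / D * n%:R^-1) ^+ 2 / (8 * N)) <=
  heat_kernel w n.*2 0 0.
Proof.
move=> xi0 n0 N0 sN o0 HJ W1; apply: le_trans (heat_kernel_diag_ge (lball d (3 * J)) n).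
rewrite ler_wpM2l ?divr_ge0 ?conductance_sum_ge0//.
set q := expR _ / _ * _.
apply: le_trans (sum_traps_le J (fun x => sqr_ge0 _)) => /=.
apply: (@le_trans _ _ (\sum_(j < J)
    q ^+ 2 / (8 * N) * trap_weight xi n%:R^-1 (3 * j) n)).
  by rewrite -mulr_sumr ler_peMr// divr_ge0 ?sqr_ge0// mulr_ge0// ltW.
apply: ler_sum => j _.
(* Escape gives hitting mass at least [2^-1] on every sphere used; in particular [hitting2] is
   nonzero and the default value of [weight] does not occur. *)
have h2 : (4 * N)^-1 <= hitting2 (3 * j) n.
  apply: sum_sqr_ge; rewrite ?sN//; apply: hitting_mass o0 _ HJ.
  by rewrite leq_mul2l/= ltnW.
have h0 : hitting2 (3 * j) n != 0.
  by rewrite gt_eqF// (lt_le_trans _ h2)// invr_gt0 mulr_gt0.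
apply: (@le_trans _ _ (q ^+ 2 / 2 *
    (hitting2 (3 * j) n * trap_weight xi n%:R^-1 (3 * j) n))).
  have -> : q ^+ 2 / (8 * N) = q ^+ 2 / 2 * (4 * N)^-1.
    by field; rewrite gt_eqF.
  rewrite -mulrA ler_wpM2l ?divr_ge0 ?sqr_ge0//.
  by rewrite ler_wpM2r ?trap_weight_ge0.
rewrite hitting2_trap_weight// mulr_sumr; apply: ler_sum => x _.
have [tr|_] := boolP (is_trap _ _ _); last first.
  by rewrite mul0r mulr0 addr_ge0 ?sqr_ge0.
apply: le_trans (trap_heat_kernel_sqr_ge (3 * j) xi0 n0 tr).
by rewrite -/q [X in _ <= _ * X]exprMn mul1r; lra.
Qed.

End Walk.

(** * Independence and the decay of trap-free environments *)

(** A smooth substitute for the indicator that traps are rare: by [prod_one_minus_ge] a value below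
    [2^-1] forces the trap weights to add up to more than 1, and the product form lets expectations
    be bounded sphere by sphere. *)
Definition trap_free (R : realType) (d : nat) (w : {fset lattice d.+1} -> R)
    (xi u : R) (n J : nat) : R :=
  \prod_(j < J) (1 - trap_weight w xi u (3 * j) n / 2).

Lemma trap_free01 (R : realType) (d : nat) (w : {fset lattice d.+1} -> R)
  (xi u : R) (n J : nat) : 0 <= trap_free w xi u n J <= 1.
Proof.
have h j : 0 <= 1 - trap_weight w xi u (3 * j) n / 2 <= 1.
  have := trap_weight_ge0 w xi u (3 * j) n.
  by have := trap_weight_le1 w xi u (3 * j) n; lra.
apply/andP; split; first by apply: prodr_ge0 => j _; have /andP[] := h j.
by apply: prodr_ile1 => j _.
Qed.

(** * Measurable dependence of the walk on the conductances *)

Section MeasurableWalk.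
Context {R : realType} {d : nat} {disp : measure_display}.
Context {T : measurableType disp}.

(* Square first, as [powR_inv1] needs a nonnegative base. *)
Lemma measurable_invr : measurable_fun [set: R] (fun x : R => x^-1).
Proof.
rewrite (_ : (fun x : R => x^-1) = fun x => x * (x ^+ 2) `^ (-1)).
  apply: measurable_funM => //; apply: (measurableT_comp (measurable_powR (-1))).
  exact: measurable_funX.
apply/funext => x; rewrite powR_inv1 ?sqr_ge0//.
by have [->|x0] := eqVneq x 0; [rewrite invr0 mul0r|field].
Qed.

Lemma measurable_sum_in (I : eqType) (s : seq I) (Q : pred I) (h : I -> T -> R) :
  (forall i, i \in s -> Q i -> measurable_fun [set: T] (h i)) ->
  measurable_fun [set: T] (fun x => \sum_(i <- s | Q i) h i x).
Proof.
move=> mh; under eq_fun do rewrite big_seq_cond big_mkcond/=.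
apply: measurable_sum => i; case: (boolP ((i \in s) && Q i)) => [/andP[si Qi]|_].
  exact: mh.
exact: measurable_cst.
Qed.

Variable w : {fset lattice d.+1} -> T -> R.

Section Ball.
Variable k : nat.
Hypothesis mw : forall e, e \in edges_within d k -> measurable_fun [set: T] (w e).

(** The sigma-algebra of [T] is arbitrary, subject to [mw]. Applied to the one generated by the
    edges of the ball, these lemmas say that the killed walk is a function of those edges alone. *)
Lemma measurable_transition z y : (norm1 z < k)%N ->
  measurable_fun [set: T] (fun s => transition (w^~ s) z y).
Proof.
move=> zk; rewrite /transition; case: (boolP (neighbor z y)) => zy; last first.
  exact: measurable_cst.
apply: measurable_funM; first exact/mw/neighbors_edges_within.
apply: (measurableT_comp measurable_invr).
under eq_fun do rewrite conductance_sumE.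
apply: measurable_sum_in => v; rewrite in_neighbors => zv _.
exact/mw/neighbors_edges_within.
Qed.

Lemma measurable_killed_kernel t y :
  measurable_fun [set: T] (fun s => killed_kernel (w^~ s) k t y).
Proof.
elim: t y => [|t IH] y /=; first exact: measurable_cst.
apply: measurable_sum_in => z _ zk; apply: measurable_funM => //.
exact: measurable_transition.
Qed.

Lemma measurable_hitting n x :
  measurable_fun [set: T] (fun s => hitting (w^~ s) k n x).
Proof. by apply: measurable_sum => i; exact: measurable_killed_kernel. Qed.

Lemma measurable_hitting2 n :
  measurable_fun [set: T] (fun s => hitting2 (w^~ s) k n).
Proof.
by apply: measurable_sum => x; apply: measurable_funX; exact: measurable_hitting.
Qed.

Lemma measurable_weight n x :
  measurable_fun [set: T] (fun s => weight (w^~ s) k n x).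
Proof.
apply: measurable_fun_ifT => //.
- by apply: measurable_fun_eqr => //; exact: measurable_hitting2.
- apply: measurable_funM; first by apply: measurable_funX; exact: measurable_hitting.
  by apply: (measurableT_comp measurable_invr); exact: measurable_hitting2.
Qed.

End Ball.

Definition trap_range (xi u : R) x (e : {fset lattice d.+1}) : set R :=
  if e == trap_bond x then `[xi, +oo[%classic else `[u, 2 * u]%classic.

Lemma measurable_trap_range xi u x e : measurable (trap_range xi u x e).
Proof. by rewrite /trap_range; case: ifP. Qed.

(** As an intersection of constraints on single edges, the trap event is a cylinder to which
    independence applies. *)
Lemma is_trapE xi u x : [set s | is_trap (w^~ s) xi u x] =
  \bigcap_(e in [set` trap_edges x]) (w e @^-1` trap_range xi u x e).
Proof.
apply/seteqP; split => [s /andP[h1 /allP h2] e /= ex|s h].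
  rewrite /trap_range; case: eqVneq => [->|ne] /=; rewrite in_itv/= ?h1//.
  by apply: h2; rewrite in_fsetD1 ne.
apply/andP; split.
  have := h _ (trap_bond_trap_edges x).
  by rewrite /trap_range eqxx /= in_itv/= andbT.
apply/allP => e; rewrite in_fsetD1 => /andP[ne ex].
by have := h _ ex; rewrite /trap_range (negbTE ne) /= in_itv.
Qed.

Lemma measurable_trap_weight xi u k n :
  (forall e, e \in edges_within d k.+3 -> measurable_fun [set: T] (w e)) ->
  measurable_fun [set: T] (fun s => trap_weight (w^~ s) xi u k n).
Proof.
move=> mw; apply: measurable_sum_in => x; rewrite in_lsphere => /eqP xk _.
apply: measurable_funM.
  by apply: measurable_weight => e /edges_withinS; move=> h; apply/mw/h; lia.
rewrite (_ : (fun s => _) = \1_[set s | is_trap (w^~ s) xi u x]).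
  rewrite is_trapE; apply: measurable_indic; apply: fin_bigcap_measurable => [|e ex].
    exact: finite_fset.
  rewrite -[X in measurable X]setTI.
  have [eS _] := trap_edges_fresh xk ex.
  by apply: mw => //; exact: measurable_trap_range.
by apply/funext => s; rewrite indicE mem_setE.
Qed.

Lemma measurable_trap_free xi u n J :
  (forall e, e \in edges_within d (3 * J) -> measurable_fun [set: T] (w e)) ->
  measurable_fun [set: T] (fun s => trap_free (w^~ s) xi u n J).
Proof.
move=> mw; apply: measurable_prod => j _; apply: measurable_funB => //.
apply: measurable_funM => //; apply: measurable_trap_weight => e /edges_withinS.
by move=> h; apply/mw/h; have := ltn_ord j; lia.
Qed.

End MeasurableWalk.

Section Restriction.
Context {R : realType} {disp : measure_display} {T : measurableType disp}.
Local Open Scope ereal_scope.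

Lemma ge0_integral_mrestr (mu : {measure set T -> \bar R}) (G : set T)
    (mG : measurable G) (f : T -> \bar R) :
  measurable_fun [set: T] f -> (forall x, 0 <= f x) ->
  \int[mrestr mu mG]_x f x = \int[mu]_(x in G) f x.
Proof.
move=> mf f0.
have GE : setT `\` ~` G = G by rewrite setDE setCK setTI.
rewrite (@ge0_negligible_integral _ _ _ _ setT (~` G))//; last 2 first.
- exact: measurableC.
- by rewrite -[LHS]/(mu (~` G `&` G)) setICl measure0.
rewrite GE; apply: eq_measure_integral => A mA AG.
by rewrite /= /mrestr setIidl.
Qed.

End Restriction.

(** * Independence of functions of disjoint finite families of coordinates *)

Section Independence.
Context {R : realType} {disp disp' : measure_display}.
Context {T : measurableType disp} {T' : measurableType disp'}.
Variables (P : probability T R) (I : choiceType) (E : set I).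
Variable X : I -> {RV P >-> T'}.
Hypothesis indX : mutually_independent E X.
Local Open Scope ereal_scope.

Definition cylinder (A : {fset I}) (B : I -> set T') : set T :=
  \bigcap_(i in [set` A]) X i @^-1` B i.

(** A pi-system generating the sigma-algebra of the coordinates in [A]. *)
Definition cylinders (A : {fset I}) : set (set T) :=
  [set cylinder A B | B in [set B | forall i, measurable (B i)]].

Lemma measurable_cylinder A B : (forall i, measurable (B i)) ->
  measurable (cylinder A B).
Proof.
move=> mB; apply: fin_bigcap_measurable => [|i _]; first exact: finite_fset.
by rewrite -[X in measurable X]setTI; exact: measurable_funP.
Qed.

Lemma measurable_coordinate A i : i \in A ->
  measurable_fun [set: g_sigma_algebraType (cylinders A)]
    (X i : g_sigma_algebraType (cylinders A) -> T').
Proof.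
move=> iA _ B mB; rewrite setTI; apply: sub_sigma_algebra.
exists (fun j => if j == i then B else setT) => /=.
  by move=> j; case: ifP.
apply/seteqP; split => [s h|s h j _].
  by have := h i iA; rewrite /= eqxx.
by rewrite /=; case: eqVneq => [->|].
Qed.

Lemma cylinder_independent (A A' : {fset I}) (B B' : I -> set T') :
  [set` A] `<=` E -> [set` A'] `<=` E -> [disjoint A & A']%fset ->
  (forall i, measurable (B i)) -> (forall i, measurable (B' i)) ->
  P (cylinder A B `&` cylinder A' B') = P (cylinder A B) * P (cylinder A' B').
Proof.
move=> AE A'E dA mB mB'.
pose C i := if i \in A then B i else B' i.
have notA i : i \in A' -> (i \in A) = false.
  move=> iA'; apply/negbTE; move/fdisjointP : dA => /(_ i) h.
  by apply/negP => /h; rewrite iA'.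
have -> : cylinder A B `&` cylinder A' B' = cylinder (A `|` A')%fset C.
  apply/seteqP; split => [s [h h'] i|s h].
    rewrite /= inE /C; case: (boolP (i \in A)) => [iA _|_ iA']; first exact: h.
    exact: h'.
  split => i /= iA.
    by have := h i; rewrite /C /= inE iA; apply.
  by have := h i; rewrite /C /= inE iA orbT notA//; apply.
rewrite !indX//; last 2 first.
- by move=> i; rewrite /= inE => /orP[/AE|/A'E].
- by move=> i; rewrite /C; case: ifP.
rewrite (perm_big (A ++ A')) /=.
  rewrite big_cat/=; congr (_ * _); rewrite big_seq [RHS]big_seq; apply: eq_bigr => i.
    by move=> iA; rewrite /C iA.
  by move=> iA'; rewrite /C notA.
apply: uniq_perm; rewrite ?cat_uniq ?fset_uniq//= ?andbT.
  by apply/hasPn => i iA'; rewrite notA.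
by move=> i; rewrite mem_cat inE.
Qed.

(** With [G] the cylinder over [A'], the finite measures sending [C] to [P (C &&& G)], the mass of
    the part of [C] inside [G], and to [P G * P C] agree on the pi-system [cylinders A], hence on
    the sigma-algebra it generates, so they give [f] the same integral. *)
Lemma integral_independent (A A' : {fset I}) (B' : I -> set T') (f : T -> R) :
  [set` A] `<=` E -> [set` A'] `<=` E -> [disjoint A & A']%fset ->
  (forall i, measurable (B' i)) -> (forall x, (0 <= f x)%R) ->
  measurable_fun [set: g_sigma_algebraType (cylinders A)]
    (f : g_sigma_algebraType (cylinders A) -> R) ->
  \int[P]_(x in cylinder A' B') (f x)%:E =
  P (cylinder A' B') * \int[P]_x (f x)%:E.
Proof.
move=> AE A'E dA mB' f0 mf; set G := cylinder A' B'.
have mG : measurable G by exact: measurable_cylinder.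
pose S := g_sigma_algebraType (cylinders A).
(* The identity onto the same set with the coarser sigma-algebra; pushing forward along it restricts
   a measure to that sigma-algebra. *)
pose phi : T -> S := idfun.
have Gm : cylinders A `<=` @measurable _ T.
  by move=> _ [B mB <-]; exact: measurable_cylinder.
have sGm := smallest_sub (@sigma_algebra_measurable _ T) Gm.
have mphi : measurable_fun [set: T] phi.
  by move=> _ B mB; rewrite setTI; exact: sGm.
have mfT : measurable_fun [set: T] f by exact: (measurableT_comp mf mphi).
have mfE : measurable_fun [set: T] (EFin \o f) by exact/measurable_EFinP.
have mfS : measurable_fun [set: S] (EFin \o f) by exact/measurable_EFinP.
have PG0 : (0 <= fine (P G))%R by rewrite fine_ge0.
pose k : {nonneg R} := NngNum PG0.
have PGE : P G = k%:num%:E by rewrite /= fineK// fin_num_measure.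
pose m1 := pushforward (mrestr P mG) phi.
pose m2 := pushforward (mscale k P) phi.
rewrite -(ge0_integral_mrestr P mG mfE); last by move=> x; rewrite lee_fin.
have -> : \int[mrestr P mG]_x (f x)%:E = \int[m1]_x ((EFin \o f) x).
  by rewrite (ge0_integral_pushforward mphi)// => y _ /=; rewrite lee_fin.
rewrite PGE -ge0_integral_mscale//; last by move=> x _; rewrite lee_fin.
have -> : \int[mscale k P]_x (f x)%:E = \int[m2]_x ((EFin \o f) x).
  by rewrite (ge0_integral_pushforward mphi)// => y _ /=; rewrite lee_fin.
apply: eq_measure_integral => C mC _.
apply: (@g_sigma_algebra_measure_unique _ R S (cylinders A) _ (fun=> setT)
  _ _ m1 m2) => //.
- by move=> D; exact: sub_sigma_algebra.
- move=> _; exists (fun=> setT) => //.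
  by rewrite /cylinder; apply/seteqP; split.
- by rewrite bigcup_const.
- move=> _ _ [B mB <-] [B1 mB1 <-]; exists (fun i => B i `&` B1 i) => /=.
    by move=> i; exact: measurableI.
  apply/seteqP; split => [s h|s [h1 h2] i iA].
    by split => i iA; have [] := h i iA.
  by split; [exact: h1|exact: h2].
- move=> _ [B mB <-]; rewrite /m1 /m2 /pushforward /= /mrestr /mscale /=.
  by rewrite [LHS]cylinder_independent// -/G PGE muleC.
- move=> _; rewrite /m1 /pushforward /mrestr /=.
  by apply: le_lt_trans (probability_le1 P (measurableI _ _ _ mG)) (ltry _); exact: measurableT.
Qed.

End Independence.

(** * Geometric decay of the expectation of [trap_free] *)

Section TrapDecay.
Context {R : realType} {d : nat} {disp : measure_display}.
Context {T : measurableType disp} (P : probability T R).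
Variable omega : {fset lattice d.+1} -> {RV P >-> R}.
Hypothesis indep : mutually_independent (@edges d.+1) omega.
Variables (xi u p : R) (n : nat).
Hypothesis p01 : (0 <= p <= 1)%R.
Hypothesis trap_ge : forall x,
  (p%:E <= P [set s | is_trap (fun e => omega e s) xi u x])%E.
Local Open Scope ereal_scope.

Let Y J s : R := trap_free (fun e => omega e s) xi u n J.

Let Y0 J s : (0 <= Y J s)%R.
Proof.
by have /andP[] := trap_free01 (fun e => omega e s) xi u n J.
Qed.

Let mY J : measurable_fun [set: T] (Y J).
Proof. by apply: measurable_trap_free => e _; exact: measurable_funP. Qed.

(* The first [J] factors and the weights on the next sphere are functions of the
   edges meeting the open ball of radius [3 * J], hence independent of the traps
   behind that sphere. *)
Lemma integral_trap_freeS J :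
  \int[P]_s (trap_free (fun e => omega e s) xi u n J.+1)%:E +
    (p / 2)%:E * \int[P]_s (trap_free (fun e => omega e s) xi u n J)%:E <=
  \int[P]_s (trap_free (fun e => omega e s) xi u n J)%:E.
Proof.
set k := (3 * J)%N.
pose Tr x := [set s | is_trap (fun e => omega e s) xi u x].
pose g x s : R := (Y J s * weight (fun e => omega e s) k n x / 2)%R.
have mTr x : measurable (Tr x).
  rewrite /Tr is_trapE; apply: measurable_cylinder => e.
  exact: measurable_trap_range.
have g0 x s : (0 <= g x s)%R by rewrite !mulr_ge0 ?weight_ge0.
have mg x : measurable_fun [set: T] (g x).
  apply: measurable_funM => //; apply: measurable_funM => //.
  by apply: measurable_weight => e _; exact: measurable_funP.
have mgE x : measurable_fun [set: T] (EFin \o g x) by exact/measurable_EFinP.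
(* The new factor is expanded as an identity between nonnegative terms, so that it can be integrated
   without subtraction in the extended reals. *)
have YE s : (Y J s)%:E = (Y J.+1 s)%:E +
    \sum_(x <- lsphere d k) ((EFin \o g x) \_ (Tr x)) s.
  rewrite (eq_bigr (fun x => (g x s * (s \in Tr x)%:R)%:E)); last first.
    by move=> x _; rewrite patchE; case: ifP; rewrite ?mulr1 ?mulr0.
  rewrite sumEFin -EFinD; congr EFin.
  have -> : Y J.+1 s =
      (Y J s * (1 - trap_weight (fun e => omega e s) xi u k n / 2))%R.
    by rewrite /Y /trap_free big_ord_recr.
  rewrite mulrBr mulr1 /trap_weight -[LHS]addr0 -addrA; congr (_ + _)%R.
  rewrite mulrA mulr_sumr mulr_suml -sumrN -big_split/= big1// => x _.
  by rewrite /g /Tr mem_setE; ring.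
have intY : \int[P]_s (Y J s)%:E = \int[P]_s (Y J.+1 s)%:E +
    \sum_(x <- lsphere d k) \int[P]_(s in Tr x) (g x s)%:E.
  under eq_integral do rewrite YE.
  rewrite ge0_integralD//; last 4 first.
  - by move=> s _; rewrite lee_fin; exact: Y0.
  - by apply/measurable_EFinP; exact: mY.
  - move=> s _; apply: sume_ge0 => x _.
    by apply: erestrict_ge0 => y _; rewrite lee_fin.
  - apply: emeasurable_sum => x.
    by apply/(measurable_restrictT _ _).1 => //; exact: measurable_funTS.
  congr (_ + _); rewrite ge0_integral_sum//.
  - by apply: eq_bigr => x _; rewrite [RHS]integral_mkcond.
  - move=> x.
    by apply/(measurable_restrictT _ _).1 => //; exact: measurable_funTS.
  - by move=> x s _; apply: erestrict_ge0 => y _; rewrite lee_fin.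
rewrite -/(Y _) [leRHS]intY leeD2l//.
have -> : (p / 2)%:E * \int[P]_s (Y J s)%:E =
    \sum_(x <- lsphere d k) p%:E * \int[P]_s (g x s)%:E.
  rewrite -ge0_sume_distrr; last by move=> x _; apply: integral_ge0 => s _; rewrite lee_fin.
  rewrite -ge0_integral_sum//; last by move=> x s _; rewrite lee_fin.
  rewrite EFinM -muleA; congr (_ * _); rewrite -ge0_integralZl_EFin//; last 2 first.
  - by move=> s _; rewrite lee_fin.
  - by apply/measurable_EFinP; exact: mY.
  apply: eq_integral => s _; rewrite sumEFin -EFinM; congr EFin.
  rewrite /g -mulr_suml -mulr_sumr sum_weight; ring.
rewrite big_seq [leRHS]big_seq; apply: lee_sum => x.
rewrite in_lsphere => /eqP xk; rewrite /Tr is_trapE.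
rewrite (@integral_independent _ _ _ _ _ _ _ _ _ indep (edges_within d k) (trap_edges x))//.
- rewrite -[X in P X]is_trapE lee_wpmul2r ?trap_ge//.
  by apply: integral_ge0 => s _; rewrite lee_fin.
- by move=> e; exact: edges_within_edges.
- by move=> e; exact: trap_edges_edges.
- apply/fdisjointP => e ek; apply/negP => ex.
  by have [_ /negP] := trap_edges_fresh xk ex.
- by move=> e; exact: measurable_trap_range.
(* The traps behind the earlier spheres also use only edges of [edges_within d k], since
   [3 * j + 3 <= k] for [j < J]. *)
- have mw e : e \in edges_within d k ->
      measurable_fun [set: g_sigma_algebraType (cylinders omega (edges_within d k))]
        (omega e : g_sigma_algebraType (cylinders omega (edges_within d k)) -> R).
    exact: measurable_coordinate.
  apply: measurable_funM => //; apply: measurable_funM.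
    exact: measurable_trap_free mw.
  exact: measurable_weight mw _ _.
Qed.

Lemma integral_trap_free_le J :
  \int[P]_s (trap_free (fun e => omega e s) xi u n J)%:E <= ((1 - p / 2) ^+ J)%:E.
Proof.
elim: J => [|J IH].
  rewrite expr0; under eq_integral do rewrite /trap_free big_ord0.
  by rewrite integral_cst// mul1e [leLHS](probability_setT P).
have := integral_trap_freeS J.
have : 0 <= \int[P]_s (trap_free (fun e => omega e s) xi u n J)%:E.
  by apply: integral_ge0 => s _; rewrite lee_fin; exact: Y0.
have : 0 <= \int[P]_s (trap_free (fun e => omega e s) xi u n J.+1)%:E.
  by apply: integral_ge0 => s _; rewrite lee_fin; exact: Y0.
move: IH; set a := integral _ _ _; set b := integral _ _ _.
case: a => [a| |]//; case: b => [b| |]//.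
rewrite -EFinM -EFinD !lee_fin exprSr => IH b0 a0 le.
have ? : (0 <= 1 - p / 2)%R by move: p01; lra.
by nra.
Qed.

(** Markov's inequality at level [2^-1]. *)
Lemma trap_free_probability J :
  P [set s | (2^-1 <= trap_free (fun e => omega e s) xi u n J)%R] <=
  (2 * (1 - p / 2) ^+ J)%:E.
Proof.
set B := [set s | _].
have mB : measurable B.
  rewrite (_ : B = Y J @^-1` `[2^-1%R, +oo[%classic).
    by rewrite -[X in measurable X]setTI; apply: mY.
  by apply/seteqP; split => s; rewrite /= in_itv/= andbT.
have mYE : measurable_fun [set: T] (EFin \o Y J) by exact/measurable_EFinP.
rewrite EFinM -lee_pdivrMl//; apply: le_trans (integral_trap_free_le J).
rewrite -(integral_cst P mB).
apply: (@le_trans _ _ (\int[P]_(s in B) (Y J s)%:E)).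
  apply: ge0_le_integral => //; first by move=> s _; rewrite lee_fin.
  exact: measurable_funTS.
by apply: ge0_subset_integral => // s _; rewrite lee_fin.
Qed.

End TrapDecay.

(** * Asymptotic estimates *)

Section Asymptotics.
Context {R : realType}.

(** Near 0 the ratio is below [gamma']; multiplying by [ln u < 0] reverses the inequality, and
    exponentiating gives the power bound. *)
Lemma powR_le_of_lne_limit (q : R -> \bar R) (gamma gamma' : R) :
  (forall u, 0 <= q u <= 1)%E ->
  (lne (q u) / (ln u)%:E)%E @[u --> 0^'+] --> gamma%:E -> gamma < gamma' ->
  \forall u \near 0^'+, ((u `^ gamma')%:E <= q u)%E.
Proof.
move=> q01 qgamma lt.
have lt' : \forall u \near 0^'+, (lne (q u) / (ln u)%:E < gamma'%:E)%E.
  by apply: (qgamma [set y | y < gamma'%:E]%E); apply: open_ereal_lt'; rewrite lte_fin.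
near=> u.
have u0 : 0 < u by near: u; exact: nbhs_right_gt.
have u1 : u < 1 by near: u; exact: nbhs_right_lt.
have l0 : ln u < 0 by rewrite ln_lt0// u0.
have : (lne (q u) / (ln u)%:E < gamma'%:E)%E by near: u.
rewrite inver lt_eqF//; have /andP[] := q01 u.
case: (q u) => [r| |]//; rewrite !lee_fin => r0 _.
(* If [q u] were 0, its logarithm would be [-oo] and the ratio [+oo], contradicting the bound by
   [gamma']. *)
have [r0'|] := leP r 0.
  rewrite le0_lneNy ?lee_fin// mulNyr ltr0_sg ?invr_lt0// mulN1e /=.
  by rewrite ltNge leey.
move=> rpos; rewrite lne_EFin// -EFinM lte_fin ltr_ndivrMr// => h.
by rewrite /powR gt_eqF// -[leRHS]lnK// ler_expR ltW.
Unshelve. all: by end_near. Qed.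

(** One term of the exponential series suffices, of an order [k.+1] with [delta * k.+1%:R >= 2]. The
    constant 6 is from [(n + 1) * (n + 2) <= 6 * n ^ 2] for [n >= 1]. *)
Lemma expR_powR_le (c delta : R) : 0 < c -> 0 < delta ->
  exists2 K, 0 < K & forall n, (0 < n)%N ->
    expR (- (c * n%:R `^ delta)) <= K / (n.+1%:R * n.+2%:R).
Proof.
move=> c0 delta0; pose k := (Num.truncn (2 / delta)).
have k2 : 2 <= delta * k.+1%:R.
  by rewrite mulrC -ler_pdivrMr// ltW// truncnS_gt.
exists (6 * k.+1`!%:R / c ^+ k.+1) => [|n n0].
  by rewrite divr_gt0 ?exprn_gt0// mulr_gt0// ltr0n fact_gt0.
have n1 : 1 <= n%:R :> R by rewrite ler1n.
have nd : n%:R ^+ 2 <= (n%:R `^ delta) ^+ k.+1 :> R.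
  rewrite -!powR_mulrn ?powR_ge0// -powRrM.
  by apply: ler_powR => //; exact: ler0n.
set y := c * n%:R `^ delta.
have y0 : 0 <= y by rewrite mulr_ge0 ?powR_ge0 ?ltW.
have ck : 0 < c ^+ k.+1 by rewrite exprn_gt0.
have f0 : 0 < k.+1`!%:R :> R by rewrite ltr0n fact_gt0.
have le : c ^+ k.+1 * n%:R ^+ 2 / k.+1`!%:R <= expR y.
  apply: le_trans (expR_ge1Dxn k y0).
  rewrite (@le_trans _ _ (y ^+ k.+1 / k.+1`!%:R)) ?lerDr//.
  by rewrite ler_wpM2r ?invr_ge0 ?(ltW f0)// /y exprMn ler_wpM2l// ltW.
rewrite expRN; have n2 : 0 < n%:R :> R by rewrite ltr0n.
apply: (@le_trans _ _ (c ^+ k.+1 * n%:R ^+ 2 / k.+1`!%:R)^-1).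
  by rewrite lef_pV2 ?posrE ?expR_gt0// !mulr_gt0 ?invr_gt0// exprn_gt0.
have -> : (c ^+ k.+1 * n%:R ^+ 2 / k.+1`!%:R)^-1 =
    k.+1`!%:R / c ^+ k.+1 * (n%:R ^+ 2)^-1.
  by field; rewrite !gt_eqF.
have -> : 6 * k.+1`!%:R / c ^+ k.+1 / (n.+1%:R * n.+2%:R) =
    k.+1`!%:R / c ^+ k.+1 * (6 / (n.+1%:R * n.+2%:R)).
  by field; rewrite !gt_eqF//; lra.
rewrite ler_wpM2l ?divr_ge0 ?(ltW f0) ?(ltW ck)//.
rewrite ler_pdivlMr ?mulr_gt0// mulrC ler_pdivrMr ?exprn_gt0//.
have e1 : n.+1%:R = n%:R + 1 :> R by rewrite -addn1 natrD.
have e2 : n.+2%:R = n%:R + 2 :> R by rewrite -addn2 natrD.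
by rewrite e1 e2; nra.
Qed.

(** Use [1 - p / 2 <= expR (- (p / 2))] and the fact that truncation at most halves a number that is
    at least 1; the two halvings give [a / 4]. *)
Lemma expr_truncn_le (a b alpha : R) (n : nat) (p := a * n%:R `^ (- b)) :
  (0 < n)%N -> 0 < alpha -> 0 <= a -> p <= 1 ->
  (1 - p / 2) ^+ Num.truncn (n%:R `^ alpha) <=
  expR (- (a / 4 * n%:R `^ (alpha - b))).
Proof.
move=> n0 alpha0 a0 p1; set J := Num.truncn _.
have n1 : 1 <= n%:R :> R by rewrite ler1n.
have na1 : 1 <= n%:R `^ alpha.
  by rewrite -[leLHS](powRr0 n%:R) ler_powR// ltW.
have /andP[J1 J2] := truncn_itv (le_trans ler01 na1).
have Jge : n%:R `^ alpha / 2 <= J%:R.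
  have : (1 <= J)%N by rewrite truncn_ge_nat// (le_trans ler01).
  by rewrite -(ler1n R); move: J2; rewrite -/J -[J.+1]addn1 natrD; lra.
have p0 : 0 <= p by rewrite mulr_ge0 ?powR_ge0.
apply: (@le_trans _ _ (expR (- (p / 2)) ^+ J)).
  by rewrite lerXn2r ?nnegrE ?expR_ge0 ?expR_ge1Dx//; lra.
rewrite -expRM_natl ler_expR mulrN lerN2.
have -> : a / 4 * n%:R `^ (alpha - b) = p / 2 * (n%:R `^ alpha / 2).
  rewrite /p powRD; first by field.
  by rewrite pnatr_eq0 -lt0n n0 implybT.
by rewrite mulrC ler_wpM2r// divr_ge0.
Qed.

End Asymptotics.

(** * Borel-Cantelli and almost sure statements *)

Section BorelCantelli.
Context {R : realType} {disp : measure_display} {T : measurableType disp}.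

Lemma sum_inv_consecutive (n : nat) :
  \sum_(i < n) (i.+1%:R * i.+2%:R)^-1 = 1 - n.+1%:R^-1 :> R.
Proof.
elim: n => [|n IH]; first by rewrite big_ord0 invr1 subrr.
rewrite big_ord_recr/= IH -[n.+2]addn1 natrD; field.
by have := ler0n R n => ?; apply/andP; split; apply: lt0r_neq0; lra.
Qed.

Lemma borel_cantelli_inv_square (P : {measure set T -> \bar R})
    (F : (set T)^nat) (K : R) : 0 <= K -> (forall n, measurable (F n)) ->
  (forall n, (P (F n) <= (K / (n.+1%:R * n.+2%:R))%:E)%E) ->
  P (lim_sup_set F) = 0%E.
Proof.
move=> K0 mF PF; apply: lim_sup_set_cvg0 => //.
apply: (@le_lt_trans _ _ K%:E); last exact: ltry.
apply: lime_le; first by apply: is_cvg_nneseries => n _ _.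
apply: nearW => n; rewrite big_mkord.
apply: (@le_trans _ _ (\sum_(i < n) (K / (i.+1%:R * i.+2%:R))%:E)%E).
  by apply: lee_sum => i _; exact: PF.
rewrite sumEFin lee_fin -mulr_sumr sum_inv_consecutive ler_piMr//.
Qed.

(** Conditioning keeps null sets null; when [D] has probability 0 the conditional probability is [P]
    itself by convention. *)
Lemma ae_cond_probability (P : probability T R) (D : set T)
    (mD : measurable D) (Q : set T) :
  {ae P, forall x, Q x} -> {ae cond_probability P mD, forall x, Q x}.
Proof.
move=> [A [mA PA QA]]; exists A; split => //.
have PAD : P (A `&` D) = 0%E.
  apply/eqP; rewrite eq_le measure_ge0 andbT -PA.
  by apply: le_measure; rewrite ?inE//; exact: measurableI.
rewrite -[LHS]/(mnormalize (mrestr P mD) P A) /mnormalize.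
case: ifP => _; first exact: PA.
by rewrite -[LHS]/(P (A `&` D) * _)%E PAD mul0e.
Qed.

Lemma ae_countable (P : probability T R) (I : countType) (Q : I -> T -> Prop) :
  (forall i, {ae P, forall x, Q i x}) -> {ae P, forall x, forall i, Q i x}.
Proof.
move=> aeQ.
have : {ae P, forall x, forall k : nat,
    if choice.unpickle k is Some i then Q i x else True}.
  apply: ae_foralln => k; case: (choice.unpickle k) => [i|]; first exact: aeQ.
  exact: aeW.
by apply: filterS => x h i; have := h (choice.pickle i); rewrite choice.pickleK.
Qed.

End BorelCantelli.

(** * The probability of a single trap *)

Section TrapProbability.
Context {R : realType} {d : nat} {disp : measure_display}.
Context {T : measurableType disp} (P : probability T R).
Variable omega : {fset lattice d.+1} -> {RV P >-> R}.
Hypothesis homega : iid (@edges d.+1) omega.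
Local Open Scope ereal_scope.

Lemma expe_le_prod (I : eqType) (s : seq I) (F : I -> \bar R) (b : R) :
  (0 <= b)%R -> (forall i, i \in s -> b%:E <= F i) ->
  (b ^+ size s)%:E <= \prod_(i <- s) F i.
Proof.
move=> b0; elim: s => [|i s IH] bF; first by rewrite big_nil.
rewrite big_cons /= exprS EFinM lee_pmul ?lee_fin ?exprn_ge0//.
  by apply: bF; rewrite mem_head.
by apply: IH => j js; apply: bF; rewrite inE js orbT.
Qed.

(** Independence gives a factor [a] for the bond and a factor [b] for each neighboring edge. Their
    number is only bounded above, which is enough because [b <= 1]. *)
Lemma trap_probability_ge (e0 : {fset lattice d.+1}) (xi u a b : R) x :
  edges e0 -> (0 <= a)%R -> (0 <= b)%R ->
  a%:E <= P [set s | (xi <= omega e0 s)%R] ->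
  b%:E <= P [set s | (u <= omega e0 s <= 2 * u)%R] ->
  (a * b ^+ (4 * d + 2))%:E <=
  P [set s | is_trap (fun e => omega e s) xi u x].
Proof.
move=> ee0 a0 b0 aP bP; have [indep idist] := homega.
have b1 : (b <= 1)%R.
  rewrite -lee_fin (le_trans bP)// probability_le1//.
  rewrite (_ : [set _ | _] = omega e0 @^-1` `[u, (2 * u)%R]%classic).
    by rewrite -[X in measurable X]setTI; exact: measurable_funP.
  by apply/seteqP; split => s; rewrite /= in_itv.
have PE e B : edges e -> measurable B -> P (omega e @^-1` B) = P (omega e0 @^-1` B).
  by move=> ee mB; have := idist _ _ ee ee0 _ mB.
rewrite is_trapE indep; last 2 first.
- by move=> e; exact: trap_edges_edges.
- by move=> e; exact: measurable_trap_range.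
rewrite (big_fsetD1 (trap_bond x)) ?trap_bond_trap_edges//= EFinM.
apply: lee_pmul; rewrite ?lee_fin ?exprn_ge0//.
  rewrite PE; [|exact: edges_trap_bond|exact: measurable_trap_range].
  rewrite /trap_range eqxx (_ : _ @^-1` _ = [set s | (xi <= omega e0 s)%R])//.
  by apply/seteqP; split => s; rewrite /= in_itv/= andbT.
apply: (@le_trans _ _ (b ^+ #|` (trap_edges x `\ trap_bond x)%fset|)%:E).
  by rewrite lee_fin ler_wiXn2l// card_trap_edges.
apply: expe_le_prod => // e; rewrite in_fsetD1 => /andP[ne ex].
rewrite PE; [|exact: trap_edges_edges ex|exact: measurable_trap_range].
rewrite /trap_range (negbTE ne).
rewrite (_ : _ @^-1` _ = [set s | (u <= omega e0 s <= 2 * u)%R])//.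
Qed.

End TrapProbability.

(** * The return probability in an environment with enough traps *)

Section Return.
Context {R : realType} {d : nat}.
Variable w : {fset lattice d.+1} -> R.
Hypothesis w01 : forall e, edges e -> 0 <= w e <= 1.
Local Notation D := (d.+1.*2%:R : R).

(** The two entries of the minimum are the constants of the confined and of the escaping case. The
    dimension is [d.+1], hence the exponent [alpha * d%:R]. *)
Lemma heat_kernel_return_ge (xi alpha : R) (n : nat) :
  0 < xi -> 0 < alpha -> alpha <= 1 -> (0 < n)%N ->
  trap_free w xi n%:R^-1 n (Num.truncn (n%:R `^ alpha)) < 2^-1 ->
  Num.min (D * 4 * 7 ^+ d.+1)^-1
          ((expR (- (2 * D / xi)) / D) ^+ 2 / (D * 16 * 7 ^+ d))
    * conductance_sum w 0 * n%:R `^ (- (2 + alpha * d%:R)) <=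
  heat_kernel w n.*2 0 0.
Proof.
move=> xi0 alpha0 alpha1 n0; set J := Num.truncn _ => free; set c := Num.min _ _.
have [pi0|pi0] := eqVneq (conductance_sum w 0) 0.
  by rewrite pi0 mulr0 mul0r heat_kernel_ge0.
have D0 : 0 < D by rewrite ltr0n.
have n1 : 1 <= n%:R :> R by rewrite ler1n.
have n0' : 0 < n%:R :> R by rewrite ltr0n.
have na1 : 1 <= n%:R `^ alpha.
  by rewrite -[leLHS](powRr0 n%:R) ler_powR// ltW.
have na0 := powR_ge0 (n%:R : R) alpha.
have /andP[J1 _] := truncn_itv na0.
have J7 : (3 * J).*2.+1%:R <= 7 * n%:R `^ alpha.
  have -> : (3 * J).*2.+1%:R = 6 * J%:R + 1 :> R.
    by rewrite -muln2 -addn1 natrD !natrM; ring.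
  by move: J1 na1; rewrite -/J; lra.
have J7k k : ((3 * J).*2.+1 ^ k)%N%:R <= 7 ^+ k * n%:R `^ (alpha * k%:R).
  rewrite powRrM powR_mulrn// -exprMn natrX.
  by rewrite lerXn2r ?nnegrE// mulr_ge0.
have c0 : 0 <= conductance_sum w 0 by exact: conductance_sum_ge0.
have [conf|esc] := leP 2^-1 (\sum_(x <- lball d (3 * J)) heat_kernel w n 0 x).
  pose N : R := 7 ^+ d.+1 * n%:R `^ (2 + alpha * d%:R).
  have N0 : 0 < N by rewrite mulr_gt0 ?exprn_gt0 ?powR_gt0.
  apply: le_trans (@heat_kernel_confined _ _ _ w01 n (lball d (3 * J)) N N0 _ conf).
    have -> : conductance_sum w 0 / D * (4 * N)^-1 =
        (D * 4 * 7 ^+ d.+1)^-1 * conductance_sum w 0 *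
        n%:R `^ (- (2 + alpha * d%:R)).
      by rewrite powRN /N; field; rewrite !gt_eqF ?exprn_gt0 ?powR_gt0.
    by rewrite !ler_wpM2r ?powR_ge0// ge_min lexx.
  apply: (@le_trans _ _ (((3 * J).*2.+1 ^ d.+1)%N%:R)).
    by rewrite ler_nat card_lball.
  apply: le_trans (J7k d.+1) _; rewrite ler_wpM2l ?exprn_ge0// ler_powR//.
  by rewrite -[d.+1]addn1 natrD mulrDr mulr1; lra.
pose N : R := 2 * 7 ^+ d * n%:R `^ (alpha * d%:R).
have N0 : 0 < N by rewrite !mulr_gt0 ?exprn_gt0 ?powR_gt0.
apply: le_trans (@heat_kernel_trapped _ _ _ w01 xi n J N xi0 n0 N0 _ pi0 esc _).
- have -> : conductance_sum w 0 / D *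
      ((expR (- (2 * D / xi)) / D * n%:R^-1) ^+ 2 / (8 * N)) =
      (expR (- (2 * D / xi)) / D) ^+ 2 / (D * 16 * 7 ^+ d) *
      conductance_sum w 0 * n%:R `^ (- (2 + alpha * d%:R)).
    rewrite powRN powRD ?pnatr_eq0 -?lt0n ?n0 ?implybT// powR_mulrn ?ler0n//.
    by rewrite /N; field; rewrite !gt_eqF ?exprn_gt0 ?powR_gt0.
  by rewrite !ler_wpM2r ?powR_ge0// ge_min lexx orbT.
- move=> j jJ; apply: (@le_trans _ _ ((2 * (3 * J).*2.+1 ^ d)%N%:R)).
    rewrite ler_nat (leq_trans (card_lsphere _ _))// leq_mul2l/=.
    have [->|d0] := posnP d; first by rewrite !expn0.
    by rewrite leq_exp2r// ltnS leq_double leq_mul2l/= ltnW.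
  by rewrite natrM /N -mulrA ler_wpM2l.
- have h (i : nat) : 0 <= trap_weight w xi n%:R^-1 (3 * i) n / 2 <= 1.
    have := trap_weight_ge0 w xi n%:R^-1 (3 * i) n.
    by have := trap_weight_le1 w xi n%:R^-1 (3 * i) n; lra.
  have := prod_one_minus_ge J h; rewrite -mulr_suml.
  by move: free; rewrite /trap_free; lra.
Qed.

End Return.

(** * Choice of the scales and almost sure conclusion *)

Theorem theorem1p1 (R : realType) (d : nat) (hd : (2 <= d)%N)
  (alpha : R) (halpha : 0 < alpha < 2^-1)
  (disp : measure_display) (T : measurableType disp) (P : probability T R)
  (omega : {fset lattice d} -> {RV P >-> R})
  (homega : iid (@edges d) omega)
  (h01 : forall e, edges e -> P [set w | 0 <= omega e w <= 1] = 1%E)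
  (hpc : forall e, edges e ->
    ((critical_probability R d)%:E < P [set w | (0 < omega e w)%R])%E)
  (gamma : R)
  (hgamma : forall e, edges e ->
    (lne (P [set w | (u <= omega e w <= 2 * u)%R]) / (ln u)%:E)%E
      @[u --> 0^'+] --> gamma%:E)
  (hgamma_lt : (4 * d%:R - 2) * gamma < alpha) :
  exists c : R, 0 < c /\
    {ae probability_o omega, forall w, \forall n \near \oo,
      c * conductance_sum (fun e => omega e w) 0
        * n%:R `^ (- (2 + alpha * (d%:R - 1)))
      <= heat_kernel (fun e => omega e w) n.*2 0 0}.
Proof.
case: d hd omega homega h01 hpc hgamma hgamma_lt => [//|d] _ omega homega h01 _.
move=> hgamma hgamma_lt.
have [alpha0 alpha2] := andP halpha.
pose m : R := (4 * d + 2)%:R.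
have mE : 4 * d.+1%:R - 2 = m by rewrite /m natrD natrM -addn1 natrD; ring.
have m0 : 0 < m by rewrite ltr0n addnS.
(* The midpoint of [gamma] and [alpha / m]: above [gamma] for the power bound, and with
   [m * gamma' < alpha] for summability. *)
pose gamma' := (gamma + alpha / m) / 2.
have gammam : gamma < alpha / m by rewrite ltr_pdivlMr// mulrC -mE.
have gamma_lt : gamma < gamma' by rewrite /gamma'; lra.
have gamma'm : m * gamma' < alpha.
  by rewrite mulrC -ltr_pdivlMr// /gamma'; lra.
pose e0 : {fset lattice d.+1} := [fset 0; outward 0]%fset.
have ee0 : edges e0 by exact/edges_neighbor/neighbor_outward.
pose q u := P [set s | (u <= omega e0 s <= 2 * u)%R].
have mq u : measurable [set s | (u <= omega e0 s <= 2 * u)%R].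
  rewrite (_ : [set _ | _] = omega e0 @^-1` `[u, (2 * u)%R]%classic).
    by rewrite -[X in measurable X]setTI; exact: measurable_funP.
  by apply/seteqP; split => s; rewrite /= in_itv.
have q01 u : (0 <= q u <= 1)%E by rewrite measure_ge0 probability_le1.
have := powR_le_of_lne_limit q01 (hgamma _ ee0) gamma_lt.
move=> [r /= r0 rq].
have qge u : 0 < u -> u < r -> ((u `^ gamma')%:E <= q u)%E.
  by move=> u0 ur; apply: rq => //=; rewrite sub0r normrN gtr0_norm.
(* Any level below [r] can serve as threshold for the bond: the power bound shows that it is
   exceeded with probability at least [a > 0]. *)
pose xi := r / 2; have xi0 : 0 < xi by rewrite divr_gt0.
pose a := xi `^ gamma'; have a0 : 0 < a by rewrite powR_gt0.
have aP : (a%:E <= P [set s | (xi <= omega e0 s)%R])%E.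
  apply: le_trans (qge xi xi0 _) _; first by rewrite /xi; lra.
  apply: le_measure; rewrite ?inE//; last by move=> s /andP[].
  rewrite (_ : [set _ | _] = omega e0 @^-1` `[xi, +oo[%classic).
    by rewrite -[X in measurable X]setTI; exact: measurable_funP.
  by apply/seteqP; split => s; rewrite /= in_itv/= andbT.
(* From [n0] on, [n%:R^-1 < r], so the power bound applies at [u = n%:R^-1] and traps have
   probability at least [p n]. *)
pose n0 := (Num.truncn r^-1).+1.
pose p n : R := a * n%:R `^ (- (m * gamma')).
have trap_ge n x : (n0 <= n)%N ->
    ((p n)%:E <= P [set s | is_trap (fun e => omega e s) xi n%:R^-1 x])%E.
  move=> nn; have n1 : (0 < n)%N by exact: leq_trans nn.
  have nr : n%:R^-1 < r.
    rewrite invf_plt ?posrE ?ltr0n//.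
    by apply: lt_le_trans (truncnS_gt _) _; rewrite ler_nat.
  have bP := qge n%:R^-1 _ nr; rewrite invr_gt0 ltr0n in bP.
  have := trap_probability_ge homega x ee0 (ltW a0) (powR_ge0 _ _) aP (bP n1).
  rewrite -powR_mulrn ?powR_ge0// -powRrM -/m.
  by rewrite -powR_inv1 ?ler0n// -[X in (_ * X)%:E]powRrM mulN1r (mulrC gamma') powR_inv1 ?ler0n.
have p0 n : 0 <= p n by rewrite mulr_ge0 ?powR_ge0 ?ltW.
have p1 n : (n0 <= n)%N -> p n <= 1.
  move=> nn; rewrite -lee_fin (le_trans (trap_ge n 0 nn))// probability_le1//.
  rewrite is_trapE; apply: measurable_cylinder => e.
  exact: measurable_trap_range.
pose J n := Num.truncn ((n%:R : R) `^ alpha).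
(* The bad events are empty below [n0], so that one summable bound covers all [n]. *)
pose F n := if (n0 <= n)%N then
  [set s | 2^-1 <= trap_free (fun e => omega e s) xi n%:R^-1 n (J n)] else set0.
have mF n : measurable (F n).
  rewrite /F; case: ifP => // _.
  rewrite (_ : [set _ | _] = (fun s => trap_free (fun e => omega e s) xi n%:R^-1 n (J n))
     @^-1` `[2^-1, +oo[%classic).
    rewrite -[X in measurable X]setTI.
    suff h : measurable_fun [set: T] (fun s =>
      trap_free (fun e => omega e s) xi n%:R^-1 n (J n)) by exact: h.
    by apply: measurable_trap_free => e _; exact: measurable_funP.
  by apply/seteqP; split => s; rewrite /= in_itv/= andbT.
have delta0 : 0 < alpha - m * gamma' by rewrite subr_gt0.
have a4 : 0 < a / 4 by rewrite divr_gt0.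
have [K K0 KP] := expR_powR_le a4 delta0.
have PF n : (P (F n) <= (2 * K / (n.+1%:R * n.+2%:R))%:E)%E.
  rewrite /F; case: ifPn => nn; last first.
    by rewrite measure0 lee_fin divr_ge0 ?mulr_ge0 ?ltW.
  have n1 : (0 < n)%N by exact: leq_trans nn.
  apply: le_trans (@trap_free_probability _ _ _ _ P omega homega.1 xi n%:R^-1 (p n) n _ _ (J n)) _.
  - by rewrite p0 p1.
  - by move=> x; exact: trap_ge.
  rewrite lee_fin -mulrA ler_pM2l//; apply: le_trans (KP n n1).
  exact: expr_truncn_le n1 alpha0 (ltW a0) (p1 _ nn).
have aeF : {ae P, forall s, ~ lim_sup_set F s}.
  exists (lim_sup_set F); split.
  - apply: bigcap_measurableType => k _; apply: bigcup_measurable => j _.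
    exact: mF.
  - by apply: borel_cantelli_inv_square PF => //; rewrite mulr_ge0// ltW.
  - by move=> s /= /contrapT.
(* All edges are handled simultaneously, as there are countably many finite sets of lattice
   points. *)
have ae01 : {ae P, forall s, forall e, edges e -> 0 <= omega e s <= 1}.
  apply: ae_countable => e; have [ee|ne] := pselect (edges e); last exact: aeW.
  have m01 : measurable [set s | 0 <= omega e s <= 1].
    rewrite (_ : [set _ | _] = omega e @^-1` `[0, 1]%classic).
      by rewrite -[X in measurable X]setTI; exact: measurable_funP.
    by apply/seteqP; split => s; rewrite /= in_itv.
  exists (~` [set s | 0 <= omega e s <= 1]); split; first exact: measurableC.
    by rewrite probability_setC// h01// subee.
  by move=> s /= h h'; apply: h.
pose D : R := d.+1.*2%:R.
exists (Num.min (D * 4 * 7 ^+ d.+1)^-1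
    ((expR (- (2 * D / xi)) / D) ^+ 2 / (D * 16 * 7 ^+ d))); split.
  rewrite lt_min invr_gt0 divr_gt0 ?exprn_gt0 ?divr_gt0 ?expR_gt0 ?ltr0n//.
    by rewrite !mulr_gt0 ?exprn_gt0 ?ltr0n.
  by rewrite !mulr_gt0 ?exprn_gt0 ?ltr0n.
rewrite /probability_o; apply: ae_cond_probability.
apply: filterS2 aeF ae01 => s /= sF s01.
have {sF} [k kF] : exists k, forall n, (k <= n)%N -> ~ F n s.
  apply: contrapT => h; apply: sF => k _; apply: contrapT => hk; apply: h.
  by exists k => n kn Fn; apply: hk; exists n.
exists (maxn k n0) => // n /=; rewrite geq_max => /andP[kn nn].
have n1 : (0 < n)%N by exact: leq_trans nn.
have -> : alpha * (d.+1%:R - 1) = alpha * d%:R by rewrite -addn1 natrD addrK.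
apply: heat_kernel_return_ge => //; first by lra.
by have := kF n kn; rewrite /F nn /= => /negP; rewrite -ltNge.
Qed.
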